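(* If $T:W5\to W5$ is a $\mathbb{Z}/2[[X,Y]]$-linear map, then $T$ is multiplication by some $u\in\mathbb{Z}/2[[X,Y]]$.
   Context: For an odd prime $p$, $T_p:\mathbb{Z}/2[[x]]\to\mathbb{Z}/2[[x]]$ is the map $\sum c_nx^n\mapsto\sum c_{pn}x^n+\sum c_nx^{pn}$. Let $D=\sum_{n>0,\ \gcd(n,6)=1}x^{n^2}$ and let $W5$ be the $\mathbb{Z}/2$-span of the $D^k$ with $k>0$, $k\equiv5\pmod 6$. $T_7$ and $T_{13}$ map each $D^{6m+5}$ to a sum of $D^{6r+5}$ with $r<m$, so $W5$ is a $\mathbb{Z}/2[[X,Y]]$-module with $X$ acting as $T_7$ and $Y$ as $T_{13}$. *)

(* Defs.v *)
From HB Require Import structures.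
From mathcomp Require Import all_boot all_order all_algebra.
From mathcomp Require Import boolp classical_sets fsbigop.

Set Implicit Arguments.
Unset Strict Implicit.
Unset Printing Implicit Defensive.

Import GRing.Theory.
Local Open Scope ring_scope.

(* A record rather than a synonym of [nat -> R], on which multiplication would
   be pointwise. *)
Record fps (R : Type) := FPS { fcoef : nat -> R }.

Lemma fpsP (R : Type) (f g : fps R) : (forall n, fcoef f n = fcoef g n) -> f = g.
Proof. by case: f g => [f] [g] /= fg; congr FPS; apply/funext. Qed.

HB.instance Definition _ (R : Type) := gen_eqMixin (fps R).
HB.instance Definition _ (R : Type) := gen_choiceMixin (fps R).

Section FpsZmod.
Variable R : zmodType.
Implicit Types f g h : fps R.

Definition fps_zero : fps R := FPS (fun _ => 0).
Definition fps_opp f := FPS (fun n => - fcoef f n).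
Definition fps_add f g := FPS (fun n => fcoef f n + fcoef g n).

Fact fps_addA : associative fps_add.
Proof. by move=> f g h; apply: fpsP => n /=; rewrite addrA. Qed.
Fact fps_addC : commutative fps_add.
Proof. by move=> f g; apply: fpsP => n /=; rewrite addrC. Qed.
Fact fps_add0 : left_id fps_zero fps_add.
Proof. by move=> f; apply: fpsP => n /=; rewrite add0r. Qed.
Fact fps_addN : left_inverse fps_zero fps_opp fps_add.
Proof. by move=> f; apply: fpsP => n /=; rewrite addNr. Qed.

HB.instance Definition _ :=
  GRing.isZmodule.Build (fps R) fps_addA fps_addC fps_add0 fps_addN.

End FpsZmod.

Section FpsRing.
Variable R : comNzRingType.
Implicit Types f g h : fps R.

Definition fps_one : fps R := FPS (fun n => (n == 0)%:R).
Definition fps_mul f g :=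
  FPS (fun n => \sum_(i < n.+1) fcoef f i * fcoef g (n - i)).

Let trunc N f : {poly R} := \poly_(i < N.+1) fcoef f i.

Let coef_trunc N f n : (n <= N)%N -> (trunc N f)`_n = fcoef f n.
Proof. by move=> nN; rewrite coef_poly ltnS nN. Qed.

Let mul_coef N f g (p q : {poly R}) :
  (forall n, (n <= N)%N -> p`_n = fcoef f n) ->
  (forall n, (n <= N)%N -> q`_n = fcoef g n) ->
  forall n, (n <= N)%N -> (p * q)`_n = fcoef (fps_mul f g) n.
Proof.
move=> pf qg n nN; rewrite coefM /=; apply: eq_bigr => i _.
rewrite pf ?qg ?(leq_trans (leq_subr _ _)) //.
by rewrite (leq_trans _ nN) // -ltnS.
Qed.

Fact fps_mulC : commutative fps_mul.
Proof.
move=> f g; apply: fpsP => n; have tr := @coef_trunc n.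
by rewrite -(mul_coef (tr f) (tr g)) // mulrC (mul_coef (tr g) (tr f)).
Qed.

Fact fps_mulA : associative fps_mul.
Proof.
move=> f g h; apply: fpsP => n; have tr := @coef_trunc n.
rewrite -(mul_coef (tr f) (mul_coef (tr g) (tr h))) // mulrA.
by rewrite (mul_coef (mul_coef (tr f) (tr g)) (tr h)).
Qed.

Fact fps_mul1 : left_id fps_one fps_mul.
Proof.
move=> f; apply: fpsP => n /=; rewrite big_ord_recl /= mul1r subn0.
by rewrite big1 ?addr0 // => i _; rewrite mul0r.
Qed.

Fact fps_mulDl : left_distributive fps_mul (@fps_add R).
Proof.
move=> f g h; apply: fpsP => n /=; rewrite -big_split /=.
by apply: eq_bigr => i _; rewrite mulrDl.
Qed.

Fact fps_one_neq0 : fps_one != 0.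
Proof.
apply/eqP => /(congr1 (fun f => fcoef f 0)) /= /eqP.
by rewrite (negbTE (oner_neq0 R)).
Qed.

HB.instance Definition _ := GRing.Zmodule_isComNzRing.Build (fps R)
  fps_mulA fps_mulC fps_mul1 fps_mulDl fps_one_neq0.

Definition fps_scale (c : R) f := FPS (fun n => c * fcoef f n).

Fact fps_scaleA a b f : fps_scale a (fps_scale b f) = fps_scale (a * b) f.
Proof. by apply: fpsP => n /=; rewrite mulrA. Qed.
Fact fps_scale1 : left_id 1 fps_scale.
Proof. by move=> f; apply: fpsP => n /=; rewrite mul1r. Qed.
Fact fps_scaleDr : right_distributive fps_scale +%R.
Proof. by move=> a f g; apply: fpsP => n /=; rewrite mulrDr. Qed.
Fact fps_scaleDl f : {morph fps_scale^~ f : a b / a + b}.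
Proof. by move=> a b; apply: fpsP => n /=; rewrite mulrDl. Qed.

HB.instance Definition _ := GRing.Zmodule_isLmodule.Build R (fps R)
  fps_scaleA fps_scale1 fps_scaleDr fps_scaleDl.

End FpsRing.

Definition hecke (p : nat) (f : fps 'F_2) : fps 'F_2 :=
  FPS (fun n => fcoef f (p * n)%N
                + (if (p %| n)%N then fcoef f (n %/ p)%N else 0)).

(* The terms x^(n^2) that contribute to x^m have n <= m. *)
Definition Dser : fps 'F_2 :=
  FPS (fun m => \sum_(1 <= n < m.+1 | coprime n 6 && (n ^ 2 == m)%N) 1).

(* Finite linear combinations of the D^k, k = 5 mod 6 (so that k > 0). *)
Definition W5 : set (fps 'F_2) := fun f =>
  exists (N : nat) (c : nat -> 'F_2),
    f = \sum_(k < N | (k %% 6 == 5)%N) c k *: Dser ^+ k.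

(* R[[X,Y]] is built as (R[[X]])[[Y]]. *)
Definition fps2 (R : Type) := fps (fps R).

Definition fcoef2 (R : Type) (u : fps2 R) (i j : nat) : R :=
  fcoef (fcoef u j) i.

(* The sum over all of nat * nat is that of [fsbigop]: the sum of the nonzero
   terms if they are finitely many, and 0 otherwise.  The second case does not
   occur for f in W5, where hecke 7 and hecke 13 are locally nilpotent. *)
Definition act (u : fps2 'F_2) (f : fps 'F_2) : fps 'F_2 :=
  \sum_(ij \in [set: nat * nat])
    fcoef2 u ij.1 ij.2 *: iter ij.1 (hecke 7) (iter ij.2 (hecke 13) f).

(* Main.v *)
(* It is enough that the socle of W5, the common kernel of T_7 and T_13, is the line
   of D^5: then lambda(f) = the coefficient of x^5 in f, which is 1 on
   D^5, makes the pairing (u, f) |-> lambda(u f) nondegenerate, so a module map T is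
   determined by lambda o T, and every linear form on W5 is f |-> lambda(u f).

   The series D and D(x^p) satisfy modular equations, for p = 7 and p = 13, that come
   from counting representations of integers by binary quadratic forms; they give
   linear recursions in k for T_p(D^k).  Writing n = sum of 4^l (i_l + 2 j_l) gives
   D^(6n+5) coordinates (i, j), where i and j have the binary digits i_l and j_l, and
   for the weight 2i + 3j the leading term of T_7 on it is (i - 1, j).  So the kernel
   of T_7 below D^(6 * 4^r + 5) has dimension at most 2^r.  It contains D^(1 + 4^(r+1)),
   and T_13^(2^r - 1) does not annihilate this power, because by unique factorization
   in Z[i], 5 * 13^(2^r - 1) = a^2 + 4^(r+1) b^2 has exactly one solution in positive
   odd a, b.  Hence T_13 acts on that kernel as a single nilpotent Jordan block, and
   the socle is a line. *)

From HB Require Import structures.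
Require Import Defs.
From mathcomp Require Import all_boot all_order all_algebra.
From mathcomp Require Import boolp classical_sets fsbigop.
From mathcomp Require Import zify ring.

Set Implicit Arguments.
Unset Strict Implicit.
Unset Printing Implicit Defensive.

Import GRing.Theory.
Local Open Scope ring_scope.

(** * Power series and Hecke operators *)

(** Let U_p and V_p be the two halves of T_p ([user], [vser]) and F the sum of x^(a^2) over odd a. D
    enters only through D = F + V_9 F and D^3 = V_3 F. Counting odd a, b with c a^2 + d b^2 = n
    relates the series F(x^m), and V_3 makes relations for D out of these. For p = 7 this yields an
    equation in D^3 and D(x^7)^3, from which a factor must be split off; for p = 13 the relation has
    level 39.

    Raising to the power 2^s is V_(2^s) in characteristic 2. So each modular equation holds with all
    exponents multiplied by 2^s, and the recursion for T_7 has steps as long as the top binary digit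
    of n, which permits an induction on binary digits. The first traces need only one coefficient of
    a series: T_p(D^(2k)) = T_p(D^k)^2, T_p annihilates the theta series D and D^3, and the
    recursion at even exponents gives the rest.

    The two estimates for the kernel of T_7 must meet exactly: an element of it is determined by its
    2^r coordinates (0, j), and the powers of T_13 provide 2^r independent elements. *)

HB.lock Definition vser [R : comNzRingType] (p : nat) (f : fps R) : fps R :=
  FPS (fun n => if (p %| n)%N then fcoef f (n %/ p)%N else 0).
HB.lock Definition user [R : comNzRingType] (p : nat) (f : fps R) : fps R :=
  FPS (fun n => fcoef f (p * n)%N).

Lemma fcoef_vser (R : comNzRingType) p (f : fps R) n :
  fcoef (vser p f) n = if (p %| n)%N then fcoef f (n %/ p)%N else 0.
Proof. by rewrite vser.unlock. Qed.
Lemma fcoef_user (R : comNzRingType) p (f : fps R) n :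
  fcoef (user p f) n = fcoef f (p * n)%N.
Proof. by rewrite user.unlock. Qed.

Lemma fcoefD (R : zmodType) (f g : fps R) n : fcoef (f + g) n = fcoef f n + fcoef g n.
Proof. by []. Qed.
Lemma fcoef0 (R : zmodType) n : fcoef (0 : fps R) n = 0.
Proof. by []. Qed.
Lemma fcoefM (R : comNzRingType) (f g : fps R) n :
  fcoef (f * g) n = \sum_(i < n.+1) fcoef f i * fcoef g (n - i).
Proof. by []. Qed.
Lemma fcoef1 (R : comNzRingType) n : fcoef (1 : fps R) n = (n == 0%N)%:R.
Proof. by []. Qed.
Lemma fcoef_sum (R : zmodType) (I : Type) (r : seq I) (P : pred I) (F : I -> fps R) n :
  fcoef (\sum_(i <- r | P i) F i) n = \sum_(i <- r | P i) fcoef (F i) n.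
Proof. by elim/big_rec2: _ => // i y x _ <-. Qed.

Lemma heckeE p f : hecke p f = user p f + vser p f.
Proof. by rewrite vser.unlock user.unlock. Qed.

Lemma userD (R : comNzRingType) p : {morph @user R p : f g / f + g}.
Proof. by move=> f g; rewrite user.unlock. Qed.
Lemma vserD (R : comNzRingType) p : {morph @vser R p : f g / f + g}.
Proof.
by move=> f g; apply: fpsP => n; rewrite !(fcoef_vser, fcoefD); case: ifP => _; rewrite ?addr0.
Qed.
Lemma user0 (R : comNzRingType) p : user p (0 : fps R) = 0.
Proof. by rewrite user.unlock. Qed.
Lemma vser0 (R : comNzRingType) p : vser p (0 : fps R) = 0.
Proof. by apply: fpsP => n; rewrite !(fcoef_vser, fcoef_user, fcoefD, fcoef0, fcoef1); case: ifP. Qed.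

Lemma vser_comp (R : comNzRingType) p q (f : fps R) : (0 < p)%N ->
  vser p (vser q f) = vser (p * q) f.
Proof.
move=> p0; apply: fpsP => n; rewrite !(fcoef_vser, fcoef_user, fcoefD, fcoef0, fcoef1).
have [/dvdnP [k ->]|pn] := boolP (p %| n)%N.
  by rewrite mulnC mulKn // dvdn_pmul2l // divnMl.
case: ifP => // /(dvdn_trans (dvdn_mulr _ (dvdnn p))); by rewrite (negbTE pn).
Qed.

Lemma vser1 (R : comNzRingType) p : (0 < p)%N -> vser p (1 : fps R) = 1.
Proof.
move=> p0; apply: fpsP => n; rewrite !(fcoef_vser, fcoef_user, fcoefD, fcoef0, fcoef1).
have [/dvdnP [k ->]|pn] := boolP (p %| n)%N; first by rewrite mulnK // muln_eq0 [p == 0%N]eqn0Ngt p0 orbF.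
by case: eqP pn => // ->; rewrite dvdn0.
Qed.

Lemma sum_multiples (R : nmodType) p n (F : nat -> R) : (0 < p)%N ->
  \sum_(i < (p * n).+1 | (p %| i)%N) F i = \sum_(j < n.+1) F (p * j)%N.
Proof.
move=> p0; have lt (j : 'I_n.+1) : (p * j < (p * n).+1)%N.
  by rewrite ltnS leq_pmul2l // -ltnS.
rewrite (reindex_onto (fun j : 'I_n.+1 => Ordinal (lt j)) (fun i => inord (i %/ p))) /=.
  apply: eq_bigl => j; rewrite dvdn_mulr //= mulKn //.
  by apply/eqP; rewrite inord_val.
move=> i /dvdnP [k ik]; apply: val_inj => /=.
rewrite ik mulnK // inordK 1?mulnC //.
by have := ltn_ord i; rewrite ik mulnC !ltnS leq_pmul2l.
Qed.

Lemma vserM (R : comNzRingType) p : (0 < p)%N -> {morph @vser R p : f g / f * g}.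
Proof.
move=> p0 f g; apply: fpsP => n.
rewrite fcoef_vser /=; under [RHS]eq_bigr do rewrite !fcoef_vser.
rewrite [RHS](bigID (fun i : 'I__ => (p %| i)%N)) /= [X in _ + X]big1 ?addr0; last first.
  by move=> i /negbTE ->; rewrite mul0r.
have [/dvdnP [k ->]|pn] := boolP (p %| n)%N; last first.
  rewrite big1 // => i pi; rewrite pi dvdn_subl ?(negbTE pn) ?mulr0 //.
  by have := ltn_ord i.
rewrite mulnK // mulnC (sum_multiples (p:=p) _ (fun i => (if (p %| i)%N then fcoef f (i %/ p)%N else 0)
  * (if (p %| p * k - i)%N then fcoef g ((p * k - i) %/ p)%N else 0))) //.
by apply: eq_bigr => j _; rewrite dvdn_mulr // mulKn // -mulnBr dvdn_mulr // mulKn.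
Qed.

(** The projection formula: V_p g has only exponents divisible by p, so U_p is linear over the image
    of V_p. *)
Lemma user_vser (R : comNzRingType) p (f g : fps R) : (0 < p)%N ->
  user p (f * vser p g) = user p f * g.
Proof.
move=> p0; apply: fpsP => n; rewrite !(fcoef_vser, fcoef_user, fcoefD, fcoef0, fcoef1).
under [LHS]eq_bigr do rewrite fcoef_vser.
rewrite [LHS](bigID (fun i : 'I__ => (p %| i)%N)) /= [X in _ + X]big1 ?addr0; last first.
  move=> i pi; rewrite dvdn_subr ?(negbTE pi) ?mulr0 //; first by rewrite -ltnS.
  by rewrite dvdn_mulr.
rewrite (sum_multiples (p:=p) _ (fun i => fcoef f i *
   (if (p %| p * n - i)%N then fcoef g ((p * n - i) %/ p)%N else 0))) //.
by apply: eq_bigr => j _; rewrite ?fcoef_user -mulnBr dvdn_mulr // mulKn.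
Qed.

Lemma vserX (R : comNzRingType) p k (f : fps R) : (0 < p)%N -> vser p (f ^+ k) = vser p f ^+ k.
Proof.
move=> p0; elim: k => [|k IH]; first by rewrite !expr0 vser1.
by rewrite !exprS vserM // IH.
Qed.

Lemma fps_neq0 (R : zmodType) (f : fps R) : f != 0 ->
  exists n, fcoef f n != 0 /\ forall m, (m < n)%N -> fcoef f m = 0.
Proof.
move=> f0; have ex : exists n, fcoef f n != 0.
  apply: contrapT => H; case/eqP: f0; apply: fpsP => n; apply/eqP/negPn/negP => h.
  by apply: H; exists n.
exists (ex_minn ex); case: ex_minnP => n h m; split=> // k kn.
by apply/eqP/negPn/negP => /m; rewrite leqNgt kn.
Qed.

Lemma fcoefM_low (R : comNzRingType) (f g : fps R) m n :
  (forall k, (k < m)%N -> fcoef f k = 0) -> (forall k, (k < n)%N -> fcoef g k = 0) ->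
  fcoef (f * g) (m + n) = fcoef f m * fcoef g n
  /\ forall k, (k < m + n)%N -> fcoef (f * g) k = 0.
Proof.
move=> f0 g0; split=> [|k kmn]; rewrite fcoefM.
  have mn : (m < (m + n).+1)%N by rewrite ltnS leq_addr.
  rewrite (bigD1 (Ordinal mn)) //= addKn big1 ?addr0 // => i /eqP im.
  have [lt|ge] := ltnP i m; first by rewrite f0 ?mul0r.
  rewrite g0 ?mulr0 //.
  have : (nat_of_ord i) <> m by move=> e; apply: im; apply: val_inj.
  move: (nat_of_ord i) (ltn_ord i) ge => j; lia.
apply: big1 => i _; have [lt|ge] := ltnP i m; first by rewrite f0 ?mul0r.
rewrite g0 ?mulr0 //; move: (nat_of_ord i) (ltn_ord i) ge => j; lia.
Qed.

Lemma fps_mulf_eq0 (R : idomainType) (f g : fps R) : f * g = 0 -> f = 0 \/ g = 0.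
Proof.
move=> fg; have [->|/fps_neq0 [m [fm fl]]] := eqVneq f 0; first by left.
have [->|/fps_neq0 [n [gn gl]]] := eqVneq g 0; first by right.
have [/eqP] := fcoefM_low fl gl.
by rewrite fg eq_sym mulf_eq0 (negbTE fm) (negbTE gn).
Qed.

Lemma fps_mulfI (R : idomainType) (f g h : fps R) : f != 0 -> f * g = f * h -> g = h.
Proof.
move=> f0 /eqP; rewrite -subr_eq0 -mulrBr => /eqP /fps_mulf_eq0 [] /eqP; first by rewrite (negbTE f0).
by rewrite subr_eq0 => /eqP.
Qed.

Lemma fps_expf_eq0 (R : idomainType) (f : fps R) n : f ^+ n = 0 -> f = 0.
Proof.
elim: n => [/eqP|n IH]; first by rewrite expr0 (negbTE (oner_neq0 _)).
by rewrite exprS => /fps_mulf_eq0 [|/IH].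
Qed.

Lemma F2_cases (c : 'F_2) : c = 0 \/ c = 1.
Proof.
case: c => -[|[|m]] i; [by left; apply: val_inj | by right; apply: val_inj |].
by have : (m.+2 < 2)%N := i.
Qed.

Lemma addff2 (c : 'F_2) : c + c = 0.
Proof. by case: (F2_cases c) => ->; apply: val_inj. Qed.

Lemma addff (f : fps 'F_2) : f + f = 0.
Proof. by apply: fpsP => n; exact: addff2. Qed.

Lemma oppff (f : fps 'F_2) : - f = f.
Proof. by apply/eqP; rewrite -subr_eq0 -opprD addff oppr0. Qed.

Lemma addff_eq0 (f g : fps 'F_2) : f + g = 0 -> f = g.
Proof. by move/eqP; rewrite addr_eq0 oppff => /eqP. Qed.

Lemma fps2_pchar : 2%N \in [pchar fps 'F_2].
Proof. by rewrite inE /=; apply/eqP; rewrite -[2%:R]/(1 + 1) addff. Qed.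

Lemma sqrfD (f g : fps 'F_2) : (f + g) ^+ 2 = f ^+ 2 + g ^+ 2.
Proof. by have := pFrobenius_autD_comm fps2_pchar (mulrC f g); rewrite !pFrobenius_autE. Qed.

Lemma exprfD2 k (f g : fps 'F_2) : (f + g) ^+ (2 ^ k) = f ^+ (2 ^ k) + g ^+ (2 ^ k).
Proof. by elim: k => [|k IH]; rewrite ?expr1 // expnS mulnC !exprM IH sqrfD. Qed.

(* In the square of f the cross terms come in equal pairs. *)
Lemma sqrf_vser (f : fps 'F_2) : f ^+ 2 = vser 2 f.
Proof.
apply: fpsP => n; rewrite expr2 fcoefM fcoef_vser.
set S := \sum_(i < _) _.
have pair : \sum_(i < n.+1 | (i < n - i)%N) fcoef f i * fcoef f (n - i) =
            \sum_(i < n.+1 | (n - i < i)%N) fcoef f i * fcoef f (n - i).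
  rewrite (reindex_inj rev_ord_inj) /=; apply: eq_big => i; first by move: (ltn_ord i); lia.
  by move=> _; rewrite subSS subKn 1?mulrC // -ltnS.
have -> : S = \sum_(i < n.+1 | (i.*2 == n)%N) fcoef f i * fcoef f (n - i).
  rewrite /S (bigID (fun i : 'I__ => (i.*2 == n)%N)) /=.
  rewrite [X in _ + X](bigID (fun i : 'I__ => (i < n - i)%N)) /=.
  rewrite [X in _ + (X + _)](eq_bigl (fun i : 'I_n.+1 => (i < n - i)%N)); last by move=> i; lia.
  rewrite [X in _ + (_ + X)](eq_bigl (fun i : 'I_n.+1 => (n - i < i)%N)); last first.
    by move=> i; move: (ltn_ord i); lia.
  by rewrite pair addff2 addr0.
have [/dvdnP [k nk]|n2] := boolP (2 %| n)%N; last by rewrite big1 // => i /eqP; move: n2; lia.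
have kn : (k < n.+1)%N by lia.
rewrite (big_pred1 (Ordinal kn)) /=; last by move=> i; rewrite /= -val_eqE /=; lia.
have -> : (n - k = k)%N by lia.
rewrite nk mulnK //; by case: (F2_cases (fcoef f k)) => ->; rewrite ?mulr0 ?mulr1.
Qed.

Lemma exprf_vser k (f : fps 'F_2) : f ^+ (2 ^ k) = vser (2 ^ k) f.
Proof.
elim: k => [|k IH]; last by rewrite expnS mulnC exprM IH sqrf_vser vser_comp // mulnC.
by apply: fpsP => n; rewrite !(fcoef_vser, fcoef_user, fcoefD, fcoef0, fcoef1) dvd1n divn1.
Qed.

Section Hecke.
Variable p : nat.
Hypothesis p_gt0 : (0 < p)%N.

Lemma heckeD : {morph hecke p : f g / f + g}.
Proof. by move=> f g; rewrite !heckeE userD vserD addrACA. Qed.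

Lemma hecke0 : hecke p 0 = 0.
Proof. by rewrite heckeE vser0 user0 addr0. Qed.

Lemma hecke_sum (I : Type) (r : seq I) (P : pred I) (F : I -> fps 'F_2) :
  hecke p (\sum_(i <- r | P i) F i) = \sum_(i <- r | P i) hecke p (F i).
Proof. exact: (big_morph _ heckeD hecke0). Qed.

Lemma hecke1 : hecke p 1 = 0.
Proof.
rewrite heckeE vser1 //; have -> : user p 1 = 1 :> fps 'F_2; last exact: addff.
by apply: fpsP => n; rewrite !(fcoef_vser, fcoef_user, fcoefD, fcoef0, fcoef1) muln_eq0 eqn0Ngt p_gt0.
Qed.

End Hecke.

Lemma vser_user_comm (R : comNzRingType) p q (f : fps R) : (0 < p)%N -> coprime p q ->
  vser p (user q f) = user q (vser p f).
Proof.
move=> p0 pq; apply: fpsP => n; rewrite !(fcoef_vser, fcoef_user, fcoefD, fcoef0, fcoef1) Gauss_dvdr //.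
by case: ifP => // pn; rewrite muln_divA.
Qed.

Lemma heckeC p q f : (0 < p)%N -> (0 < q)%N -> coprime p q ->
  hecke p (hecke q f) = hecke q (hecke p f).
Proof.
move=> p0 q0 pq; rewrite !heckeE !userD !vserD !vser_comp //.
rewrite (@vser_user_comm _ p q) // -(@vser_user_comm _ q p) // 1?coprime_sym // (mulnC q p).
have -> : user p (user q f) = user q (user p f).
  by apply: fpsP => n; rewrite !(fcoef_vser, fcoef_user, fcoefD, fcoef0, fcoef1) !mulnA (mulnC p q).
rewrite -!addrA; congr (_ + _); rewrite !addrA; congr (_ + _); exact: addrC.
Qed.

(** Squaring is [vser 2], which commutes with U_p because p is odd. *)
Lemma hecke_sqr p f : odd p -> hecke p (f ^+ 2) = hecke p f ^+ 2.
Proof.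
move=> op; have p0 : (0 < p)%N by case: p op.
rewrite !sqrf_vser !heckeE !vserD -vser_user_comm ?coprime2n //.
by rewrite !vser_comp // (mulnC p 2).
Qed.

(* The trace form of Newton's recursion: the D(x^p) and D(zeta x^(1/p)) are
   the roots of the modular equation over F_2(D). *)
Lemma hecke_rec p (f : fps 'F_2) (L : seq (nat * nat)) k : (0 < p)%N ->
  \sum_(ab <- L) f ^+ ab.1 * vser p f ^+ ab.2 = 0 ->
  \sum_(ab <- L) f ^+ ab.2 * vser p f ^+ ab.1 = 0 ->
  \sum_(ab <- L) f ^+ ab.1 * hecke p (f ^+ (k + ab.2)) = 0.
Proof.
move=> p0 H1 H2.
under eq_bigr do rewrite heckeE mulrDr.
rewrite big_split /= [X in X + _](_ : _ = 0) ?add0r.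
  transitivity (vser p f ^+ k * \sum_(ab <- L) f ^+ ab.1 * vser p f ^+ ab.2).
    by rewrite mulr_sumr; apply: eq_bigr => ab _; rewrite vserX // exprD; ring.
  by rewrite H1 mulr0.
(* By [user_vser] the powers of [vser p f] leave U_p as powers of f; this uses the relation with
   exchanged exponents. *)
transitivity (user p (f ^+ k * \sum_(ab <- L) f ^+ ab.2 * vser p f ^+ ab.1)).
  rewrite mulr_sumr (big_morph _ (@userD _ p) (@user0 _ p)).
  by apply: eq_bigr => ab _; rewrite mulrA -exprD -vserX // user_vser // mulrC.
by rewrite H2 mulr0 user0.
Qed.

(** * Representations by binary quadratic forms *)

HB.lock Definition theta (P : pred nat) : fps 'F_2 :=
  FPS (fun m => (\sum_(a < m.+1) (P a && (a ^ 2 == m)%N))%:R).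

Lemma fcoef_theta P m :
  fcoef (theta P) m = (\sum_(a < m.+1) (P a && (a ^ 2 == m)%N))%:R.
Proof. by rewrite theta.unlock. Qed.

Lemma fcoef_vser_theta c P n N : (0 < c)%N -> (n <= N)%N ->
  fcoef (vser c (theta P)) n = (\sum_(a < N.+1) (P a && (c * a ^ 2 == n)%N))%:R.
Proof.
move=> c0 nN; rewrite fcoef_vser; have [/dvdnP [k nk]|cn] := boolP (c %| n)%N; last first.
  rewrite big1 // => a _; case: eqP => [e|_]; last by rewrite andbF.
  by rewrite -e dvdn_mulr in cn.
rewrite {n}nk in nN *; rewrite mulnK // fcoef_theta; congr (_%:R).
rewrite -(big_mkord xpredT (fun a => nat_of_bool (P a && (a ^ 2 == k)%N))).
rewrite -(big_mkord xpredT (fun a => nat_of_bool (P a && (c * a ^ 2 == k * c)%N))).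
have kN : (k <= N)%N by rewrite (leq_trans _ nN) // leq_pmulr.
rewrite (big_cat_nat (n := k.+1) (p := N.+1)) //= [X in _ = (_ + X)%N]big_nat [X in _ = (_ + X)%N]big1 ?addn0.
  by apply: eq_bigr => a _; rewrite (mulnC k) eqn_pmul2l.
move=> a /andP [ka _]; rewrite (mulnC k) eqn_pmul2l //.
by case: eqP => [|_]; [nia | rewrite andbF].
Qed.

Lemma fcoef_theta2 c d P Q n : (0 < c)%N -> (0 < d)%N ->
  fcoef (vser c (theta P) * vser d (theta Q)) n =
  (\sum_(a < n.+1) \sum_(b < n.+1) [&& P a, Q b & (c * a ^ 2 + d * b ^ 2 == n)%N])%:R.
Proof.
move=> c0 d0; rewrite fcoefM.
have le (i : 'I_n.+1) : (i <= n)%N by rewrite -ltnS.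
under eq_bigr => i _ do rewrite (@fcoef_vser_theta c P i n) ?le //
  (@fcoef_vser_theta d Q (n - i)%N n) ?leq_subr // -natrM big_distrlr /=.
rewrite -natr_sum exchange_big; congr (_%:R); apply: eq_bigr => a _.
rewrite exchange_big; apply: eq_bigr => b _ /=.
under eq_bigr => i _ do rewrite mulnb.
have [/eqP e|ne] := boolP (c * a ^ 2 + d * b ^ 2 == n)%N; last first.
  rewrite !andbF big1 // => i _; case: eqP => [e1|_]; last by rewrite andbF.
  case: eqP => [e2|_]; last by rewrite !andbF.
  by case/eqP: ne; rewrite e1 e2 subnKC.
have lt : (c * a ^ 2 < n.+1)%N by rewrite ltnS -[X in (_ <= X)%N]e leq_addr.
have en : (n - c * a ^ 2 = d * b ^ 2)%N by rewrite -[X in (X - _)%N]e addKn.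
rewrite (bigD1 (Ordinal lt)) //= eqxx en !eqxx !andbT big1 ?addn0 // => i /eqP ne.
case: eqP => [e1|_]; last by rewrite andbF.
by case: ne; apply: val_inj; rewrite /= e1.
Qed.

(** Positive pairs are counted inside a box of Z^2, because the bijections below are linear and mix
    signs. The order 0, 1, -1, 2, -2, ... splits a sum into pairs of opposite signs. *)
Definition zrange (N : nat) : seq int :=
  0 :: flatten [seq [:: Posz a.+1; - Posz a.+1] | a <- iota 0 N].
Definition zbox (N : nat) : seq (int * int) :=
  [seq (a, b) | a <- zrange N, b <- zrange N].

Lemma mem_zrange N (x : int) : (x \in zrange N) = (`|x| <= N)%N.
Proof.
rewrite /zrange inE; apply/orP/idP => [[/eqP -> //|/flattenP [s /mapP [a]]]|].
  by rewrite mem_iota => /andP [_ aN] -> ; rewrite !inE => /orP [] /eqP ->; lia.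
have [-> _|x0 xN] := eqVneq x 0; [by left | right].
apply/flattenP; exists [:: Posz `|x|.-1.+1; - Posz `|x|.-1.+1].
  by apply/mapP; exists `|x|.-1 => //; rewrite mem_iota; lia.
by rewrite !inE; lia.
Qed.

Lemma uniq_zrange N : uniq (zrange N).
Proof.
rewrite /zrange /=; apply/andP; split.
  by apply/flattenP => -[s /mapP [a _ ->]]; rewrite !inE; lia.
elim: N 0%N => //= N IH m; rewrite IH andbT inE negb_or -andbA.
by apply/and3P; split; first lia;
  apply/flattenP => -[s /mapP [a]]; rewrite mem_iota => am ->; rewrite !inE; lia.
Qed.

Lemma mem_zbox N (p : int * int) : (p \in zbox N) = (`|p.1| <= N)%N && (`|p.2| <= N)%N.
Proof.
case: p => a b /=; rewrite -!mem_zrange; apply/allpairsP/andP => [[[x y] /= [? ? [-> ->]]]|[? ?]] //.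
by exists (a, b).
Qed.

Lemma uniq_zbox N : uniq (zbox N).
Proof. by apply: allpairs_uniq; rewrite ?uniq_zrange // => -[? ?] [? ?] _ _ [-> ->]. Qed.

Lemma count_zbox_bij N (P Q : pred (int * int)) (f g : int * int -> int * int) :
  (forall x, P x -> x \in zbox N) -> (forall y, Q y -> y \in zbox N) ->
  (forall x, P x -> Q (f x) /\ g (f x) = x) ->
  (forall y, Q y -> P (g y) /\ f (g y) = y) ->
  count P (zbox N) = count Q (zbox N).
Proof.
move=> PN QN Pf Qg; rewrite -!size_filter -(size_map f); apply/perm_size/uniq_perm.
- rewrite map_inj_in_uniq ?filter_uniq ?uniq_zbox // => x y.
  rewrite !mem_filter => /andP [Px _] /andP [Py _] fxy.
  by rewrite -(Pf x Px).2 fxy (Pf y Py).2.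
- by rewrite filter_uniq ?uniq_zbox.
move=> y; rewrite mem_filter; apply/mapP/andP => [[x]|[Qy yN]].
  by rewrite mem_filter => /andP [/Pf [Qx _] _] ->; split=> //; exact: QN.
have [Pg fg] := Qg y Qy; exists (g y) => //.
by rewrite mem_filter Pg PN.
Qed.

Lemma sum_zrange N (F : int -> nat) :
  (\sum_(x <- zrange N) F x = F 0%R + \sum_(a < N) (F (Posz a.+1) + F (- Posz a.+1)%R))%N.
Proof.
rewrite /zrange big_cons; congr (_ + _)%N.
rewrite big_flatten /= big_map -(big_mkord xpredT (fun a => F (Posz a.+1) + F (- Posz a.+1)%R)%N).
rewrite /index_iota subn0; apply: eq_bigr => a _.
by rewrite !big_cons big_nil addn0.
Qed.

Lemma count_zbox N (P : pred (int * int)) :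
  count P (zbox N) =
  (P (0%R, 0%R) + \sum_(b < N) (P (0%R, Posz b.+1) + P (0%R, - Posz b.+1)%R)
   + \sum_(a < N) (P (Posz a.+1, 0%R) + P (- Posz a.+1, 0)%R)
   + \sum_(a < N) \sum_(b < N)
       (P (Posz a.+1, Posz b.+1) + P (Posz a.+1, - Posz b.+1)%R
        + P (- Posz a.+1, Posz b.+1)%R + P (- Posz a.+1, - Posz b.+1)%R))%N.
Proof.
rewrite -sum1_count big_mkcond /= /zbox big_allpairs_dep /=.
under eq_bigr => x _ do rewrite (sum_zrange _ (fun y => nat_of_bool (P (x, y)))).
rewrite (sum_zrange _ (fun x => P (x, 0%R) + \sum_(b < N) (P (x, Posz b.+1) + P (x, - Posz b.+1)%R))%N).
rewrite -!addnA; congr (_ + (_ + _))%N; rewrite -big_split /=; apply: eq_bigr => a _.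
rewrite addnACA -big_split /=; congr (_ + _)%N; apply: eq_bigr => b _; lia.
Qed.

Section BinaryForm.
Variables (c d n : nat).
Hypotheses (c_gt0 : (0 < c)%N) (d_gt0 : (0 < d)%N).

Definition zform (p : int * int) : bool := c%:Z * p.1 ^+ 2 + d%:Z * p.2 ^+ 2 == n%:Z.

Definition odd_reps : nat :=
  \sum_(a < n) \sum_(b < n) [&& odd a.+1, odd b.+1 & (c * a.+1 ^ 2 + d * b.+1 ^ 2 == n)%N].
Definition mixed_reps : nat :=
  \sum_(a < n) \sum_(b < n) (odd (a.+1 + b.+1) && (c * a.+1 ^ 2 + d * b.+1 ^ 2 == n)%N).

Lemma zform_box p : zform p -> p \in zbox n.
Proof. by case: p => a b /eqP /= H; rewrite mem_zbox /=; apply/andP; split; nia. Qed.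
End BinaryForm.

Definition odd_sqr_reps (c n : nat) : nat := \sum_(a < n) (odd a.+1 && (c * a.+1 ^ 2 == n)%N).

Definition odd2 (p : int * int) := (p.1 %% 2 == 1)%Z && (p.2 %% 2 == 1)%Z.

(** [s] is how many of the four sign choices of an odd pair satisfy [h]; pairs with a zero
    coordinate are not odd. *)
Lemma count_odd_class s (h : pred (int * int)) c d n :
  (forall a b : nat, odd a -> odd b ->
     h (Posz a, Posz b) + h (Posz a, - Posz b)%R + h (- Posz a, Posz b)%R
     + h (- Posz a, - Posz b)%R = s)%N ->
  count (fun p => [&& odd2 p, h p & zform c d n p]) (zbox n) = (s * odd_reps c d n)%N.
Proof.
move=> hs; rewrite count_zbox /odd2 /= /zform /=.
have z0 : (0 %% 2 == 1 :> int)%Z = false by [].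
rewrite z0 [X in (_ + X + _ + _)%N]big1 => [|b _]; last by [].
rewrite [X in (_ + X + _)%N]big1 => [|a _]; last by rewrite !andbF.
rewrite /odd_reps big_distrr; apply: eq_bigr => a _; rewrite big_distrr; apply: eq_bigr => b _ /=.
have oP (x : nat) : (Posz x %% 2 == 1)%Z = odd x by lia.
have oN (x : nat) : (- Posz x %% 2 == 1)%Z = odd x by lia.
rewrite !oP !oN !sqrrN -[~~ odd a]/(odd a.+1) -[~~ odd b]/(odd b.+1).
have -> : (c%:Z * a.+1%:Z ^+ 2 + d%:Z * b.+1%:Z ^+ 2 == n%:Z) = (c * a.+1 ^ 2 + d * b.+1 ^ 2 == n)%N by lia.
case: (boolP (odd a.+1)) => oa; last by rewrite !andFb muln0.
case: (boolP (odd b.+1)) => ob; last by rewrite ?andbF ?andFb muln0.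
case: (_ == n)%N; last by rewrite ?andbF ?andFb muln0.
by rewrite !andbT !andTb muln1 -(hs _ _ oa ob).
Qed.

Lemma count_mixed c d n :
  count (fun p => ((p.1 + p.2) %% 2 == 1)%Z && zform c d n p) (zbox n) =
  (4 * mixed_reps c d n + 2 * odd_sqr_reps c n + 2 * odd_sqr_reps d n)%N.
Proof.
rewrite count_zbox /= /zform /=.
rewrite [X in (_ + X + _ + _)%N](_ : _ = 2 * odd_sqr_reps d n)%N; last first.
  rewrite /odd_sqr_reps big_distrr; apply: eq_bigr => b _; rewrite !sqrrN.
  have -> : ((0 + Posz b.+1) %% 2 == 1)%Z = odd b.+1 by lia.
  have -> : ((0 + - Posz b.+1) %% 2 == 1)%Z = odd b.+1 by lia.
  have -> : (c%:Z * 0 ^+ 2 + d%:Z * b.+1%:Z ^+ 2 == n%:Z) = (d * b.+1 ^ 2 == n)%N by lia.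
  by rewrite addnn -mul2n.
rewrite [X in (_ + X + _)%N](_ : _ = 2 * odd_sqr_reps c n)%N; last first.
  rewrite /odd_sqr_reps big_distrr; apply: eq_bigr => b _; rewrite !sqrrN.
  have -> : ((Posz b.+1 + 0) %% 2 == 1)%Z = odd b.+1 by lia.
  have -> : ((- Posz b.+1 + 0) %% 2 == 1)%Z = odd b.+1 by lia.
  have -> : (c%:Z * b.+1%:Z ^+ 2 + d%:Z * 0 ^+ 2 == n%:Z) = (c * b.+1 ^ 2 == n)%N by lia.
  by rewrite addnn -mul2n.
rewrite [X in (_ + X)%N](_ : _ = 4 * mixed_reps c d n)%N; first lia.
rewrite /mixed_reps big_distrr.
apply: eq_bigr => a _; rewrite big_distrr; apply: eq_bigr => b _ /=.
rewrite !sqrrN.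
have -> : (c%:Z * a.+1%:Z ^+ 2 + d%:Z * b.+1%:Z ^+ 2 == n%:Z) = (c * a.+1 ^ 2 + d * b.+1 ^ 2 == n)%N by lia.
have -> : ((Posz a.+1 + Posz b.+1) %% 2 == 1)%Z = odd (a.+1 + b.+1) by lia.
have -> : ((Posz a.+1 + - Posz b.+1) %% 2 == 1)%Z = odd (a.+1 + b.+1) by lia.
have -> : ((- Posz a.+1 + Posz b.+1) %% 2 == 1)%Z = odd (a.+1 + b.+1) by lia.
have -> : ((- Posz a.+1 + - Posz b.+1) %% 2 == 1)%Z = odd (a.+1 + b.+1) by lia.
by case: (_ && _).
Qed.

(** The involution (a, b) |-> (-a, -b) has no fixed point among the odd pairs. *)
Lemma count_even_odd2 (h : pred (int * int)) c d n :
  (forall a b : int, h (- a, - b)%R = h (a, b)) ->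
  ~~ odd (count (fun p => [&& odd2 p, h p & zform c d n p]) (zbox n)).
Proof.
move=> hN; rewrite count_zbox /odd2 /= /zform /=.
have z0 : (0 %% 2 == 1 :> int)%Z = false by [].
rewrite z0 [X in (_ + X + _ + _)%N]big1 => [|b _]; last by [].
rewrite [X in (_ + X + _)%N]big1 => [|a _]; last by rewrite !andbF.
rewrite !add0n.
elim/big_ind: _ => // [x y|a _]; first by rewrite oddD => /negbTE -> /negbTE ->.
elim/big_ind: _ => // [x y|b _]; first by rewrite oddD => /negbTE -> /negbTE ->.
have -> : h (- Posz a.+1, - Posz b.+1)%R = h (Posz a.+1, Posz b.+1) by rewrite hN.
have -> : h (- Posz a.+1, Posz b.+1)%R = h (Posz a.+1, - Posz b.+1)%R by rewrite -hN opprK.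
have oP (x : nat) : (Posz x %% 2 == 1)%Z = odd x by lia.
have oN (x : nat) : (- Posz x %% 2 == 1)%Z = odd x by lia.
have E (x y : nat) : ~~ odd (x + y + y + x) by lia.
by rewrite !oP !oN !sqrrN E.
Qed.

Lemma odd_reps_fcoef c d n : (0 < c)%N -> (0 < d)%N ->
  fcoef (vser c (theta odd) * vser d (theta odd)) n = (odd_reps c d n)%:R.
Proof.
move=> c0 d0; rewrite fcoef_theta2 //; congr (_%:R).
rewrite big_ord_recl [X in (X + _)%N]big1 // add0n; apply: eq_bigr => a _.
by rewrite big_ord_recl andbF add0n; apply: eq_bigr => b _.
Qed.

Lemma odd_sqr_reps_fcoef c n : (0 < c)%N ->
  fcoef (vser c (theta odd)) n = (odd_sqr_reps c n)%:R.
Proof.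
by move=> c0; rewrite (@fcoef_vser_theta c odd n n) // big_ord_recl add0n.
Qed.

(** (c + d sqrt(-3)) (1 + sqrt(-3)) = (c - 3d) + (c + d) sqrt(-3), and 1 + sqrt(-3) has norm 4. Two
    of the four sign choices of an odd pair (a, b) satisfy a = b mod 4, and these are the products
    with c + d = b odd. *)
Lemma odd_reps_1_3 n : odd_reps 1 3 n =
  (2 * mixed_reps 4 12 n + odd_sqr_reps 4 n + odd_sqr_reps 12 n)%N.
Proof.
pose h (p : int * int) := ((p.1 - p.2) %% 4 == 0)%Z.
have h2 : forall a b : nat, odd a -> odd b ->
     (h (Posz a, Posz b) + h (Posz a, - Posz b)%R + h (- Posz a, Posz b)%R
     + h (- Posz a, - Posz b)%R = 2)%N.
  by move=> a b oa ob; rewrite /h /=; lia.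
have E := count_odd_class 1 3 n h2.
have := count_mixed 4 12 n.
rewrite -(@count_zbox_bij n (fun p => [&& odd2 p, h p & zform 1 3 n p]) _
  (fun p => ((p.1 + 3 * p.2) %/ 4, (p.2 - p.1) %/ 4)%Z)
  (fun p => (p.1 - 3 * p.2, p.1 + p.2))); first by rewrite E; lia.
- by move=> x /and3P [_ _ /zform_box]; apply.
- by move=> x /andP [_ /zform_box]; apply.
- move=> [a b] /and3P [/andP /= [oa ob] hab /eqP /= q]; rewrite /h /= in hab.
  have [c [d [ea eb]]] : exists c d : int, a = c - 3 * d /\ b = c + d.
    by exists ((a + 3 * b) %/ 4)%Z, ((b - a) %/ 4)%Z; lia.
  have -> : ((a + 3 * b) %/ 4 = c)%Z by lia.
  have -> : ((b - a) %/ 4 = d)%Z by lia.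
  split; last by rewrite ea eb.
  apply/andP; split; first by rewrite /=; lia.
  by apply/eqP; rewrite -q ea eb /=; ring.
move=> [c d] /andP [/= oc /eqP /= q]; split; last by congr pair; lia.
apply/and3P; split; rewrite /odd2 /h /=; [lia | lia |].
by apply/eqP; rewrite -q /=; ring.
Qed.

(* Halving when both coordinates are even. *)
Lemma count_sum_2mod4 c d n : (0 < c)%N -> (0 < d)%N ->
  count (fun p => ((p.1 + p.2) %% 4 == 2)%Z && zform c d n p) (zbox n) =
  (2 * odd_reps c d n + (4 * mixed_reps (4 * c) (4 * d) n
   + 2 * odd_sqr_reps (4 * c) n + 2 * odd_sqr_reps (4 * d) n))%N.
Proof.
move=> c0 d0; rewrite -(count_odd_class (s := 2) (h := fun p => ((p.1 + p.2) %% 4 == 2)%Z)); last first.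
  by move=> a b oa ob /=; lia.
rewrite -count_mixed -(@count_zbox_bij n
  (fun p => [&& ~~ odd2 p, ((p.1 + p.2) %% 4 == 2)%Z & zform c d n p])
  (fun p => ((p.1 + p.2) %% 2 == 1)%Z && zform (4 * c) (4 * d) n p)
  (fun p => (p.1 %/ 2, p.2 %/ 2)%Z) (fun p => (2 * p.1, 2 * p.2))).
- rewrite -count_predUI [X in (_ + X)%N](_ : _ = 0%N) ?addn0.
    by apply: eq_count => p /=; case: (odd2 p); rewrite /= ?orbF.
  by rewrite -[RHS](count_pred0 (zbox n)); apply: eq_count => p /=; case: (odd2 p); rewrite /= ?andbF.
- by move=> x /and3P [_ _ /zform_box]; apply.
- by move=> x /andP [_ /zform_box]; apply; lia.
- move=> [a b] /and3P [/= ho hab /eqP /= q]; rewrite /odd2 /= in ho.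
  have [a' [b' [ea eb]]] : exists c d : int, a = 2 * c /\ b = 2 * d.
    by exists (a %/ 2)%Z, (b %/ 2)%Z; lia.
  have -> : (a %/ 2 = a')%Z by lia.
  have -> : (b %/ 2 = b')%Z by lia.
  split; last by rewrite ea eb.
  apply/andP; split; first by rewrite /=; lia.
  by apply/eqP; rewrite -q ea eb /= !PoszM; ring.
move=> [a b] /andP [/= oc /eqP /= q]; split; last by congr pair; lia.
apply/and3P; split; rewrite /odd2 /=; [lia | lia |].
by apply/eqP; rewrite -q /= !PoszM; ring.
Qed.

(** The same argument with (1 + sqrt(-7)) / 2, of norm 2. Here b = (c + d) / 2 has to be odd, hence
    c + d = 2 mod 4. *)
Lemma odd_reps_1_7 n : odd_reps 1 7 n =
  (odd_reps 2 14 n + 2 * mixed_reps 8 56 n + odd_sqr_reps 8 n + odd_sqr_reps 56 n)%N.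
Proof.
pose h (p : int * int) := ((p.1 - p.2) %% 4 == 0)%Z.
have h2 : forall a b : nat, odd a -> odd b ->
     (h (Posz a, Posz b) + h (Posz a, - Posz b)%R + h (- Posz a, Posz b)%R
     + h (- Posz a, - Posz b)%R = 2)%N.
  by move=> a b oa ob; rewrite /h /=; lia.
have E := count_odd_class 1 7 n h2.
have := @count_sum_2mod4 2 14 n isT isT; rewrite -[(4 * 2)%N]/8%N -[(4 * 14)%N]/56%N.
rewrite -(@count_zbox_bij n (fun p => [&& odd2 p, h p & zform 1 7 n p]) _
  (fun p => ((p.1 + 7 * p.2) %/ 4, (p.2 - p.1) %/ 4)%Z)
  (fun p => ((p.1 - 7 * p.2) %/ 2, (p.1 + p.2) %/ 2)%Z)); first by rewrite E; lia.
- by move=> x /and3P [_ _ /zform_box]; apply.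
- by move=> x /andP [_ /zform_box]; apply.
- move=> [a b] /and3P [/andP /= [oa ob] hab /eqP /= q]; rewrite /h /= in hab.
  have [d ed] : exists d : int, b - a = 4 * d by exists ((b - a) %/ 4)%Z; lia.
  have -> : ((a + 7 * b) %/ 4 = 2 * b - d)%Z by lia.
  have -> : ((b - a) %/ 4 = d)%Z by lia.
  split; last by congr pair; lia.
  apply/andP; split; first by rewrite /=; lia.
  by apply/eqP; rewrite -q /= (_ : a = b - 4 * d); [ring | lia].
move=> [c d] /andP [/= oc /eqP /= q].
have [b eb] : exists b : int, c + d = 2 * b by exists ((c + d) %/ 2)%Z; lia.
have -> : ((c - 7 * d) %/ 2 = b - 4 * d)%Z by lia.
have -> : ((c + d) %/ 2 = b)%Z by lia.
split; last by congr pair; lia.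
apply/and3P; split; rewrite /odd2 /h /=; [lia | lia |].
by apply/eqP; rewrite -q /= (_ : c = 2 * b - d); [ring | lia].
Qed.

(** For odd a, b one of a = b, -b, 3b, -3b holds mod 8, and changes of sign make each of the two odd
    counts half of the sum of its classes k = 1 and k = 3. By E1 the two forms share a class, which
    therefore enters the total once and is even. E2 and E3 carry the other two classes to pairs with
    c + d = 2 mod 4 for the forms (12, 52) and (4, 156). *)
Lemma odd_reps_39 n :
  odd (odd_reps 3 13 n + odd_reps 1 39 n) =
  odd (odd_reps 12 52 n + odd_reps 4 156 n
   + odd_sqr_reps 16 n + odd_sqr_reps 48 n + odd_sqr_reps 208 n + odd_sqr_reps 624 n).
Proof.
pose cl (k : int) (p : int * int) := ((p.1 - k * p.2) %% 8 == 0)%Z.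
pose S c d k := count (fun p => [&& odd2 p, cl k p & zform c d n p]) (zbox n).
have symS c d k : (0 < c)%N -> (0 < d)%N -> S c d (- k) = S c d k.
  move=> c0 d0; apply: (@count_zbox_bij n _ _ (fun p => (p.1, - p.2)) (fun p => (p.1, - p.2))).
  - by move=> x /and3P [_ _ /zform_box]; apply.
  - by move=> x /and3P [_ _ /zform_box]; apply.
  - move=> [a b] /and3P []; rewrite /odd2 /cl /zform /= => /andP [oa ob] hab q.
    by split; last rewrite opprK //; apply/and3P; split; rewrite ?sqrrN //; lia.
  move=> [a b] /and3P []; rewrite /odd2 /cl /zform /= => /andP [oa ob] hab q.
  by split; last rewrite opprK //; apply/and3P; split; rewrite ?sqrrN //; lia.
have splitS c d : (0 < c)%N -> (0 < d)%N -> (4 * odd_reps c d n = 2 * S c d 1 + 2 * S c d 3)%N.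
  move=> c0 d0; rewrite -(@count_odd_class 4 xpredT) //.
  have -> : (2 * S c d 1 + 2 * S c d 3 = (S c d 1 + S c d (- 1)%R) + (S c d 3 + S c d (- 3)%R))%N.
    by rewrite (symS c d 1) // (symS c d 3) //; move: (S c d 1) (S c d 3) => x y; lia.
  rewrite /S; elim: (zbox n) => //= -[a b] l -> /=.
  rewrite /odd2 /cl /=; case: (zform _ _ _ _); rewrite ?andbF //= ?andbT.
  by move: (count _ _) (count _ _) (count _ _) (count _ _) => x y z t; lia.
have evenS c d k : ~~ odd (S c d k).
  by apply: count_even_odd2 => a b; rewrite /cl /=; lia.
have E1 : S 1%N 39%N 1 = S 3%N 13%N 3.
  rewrite -symS //.
  apply: (@count_zbox_bij n _ _ (fun p => ((p.1 + 13 * p.2) %/ 4, (3 * p.2 - p.1) %/ 4)%Z)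
     (fun p => ((3 * p.1 - 13 * p.2) %/ 4, (p.1 + p.2) %/ 4)%Z)).
  - by move=> x /and3P [_ _ /zform_box]; apply.
  - by move=> x /and3P [_ _ /zform_box]; apply.
  - move=> [a b] /and3P []; rewrite /odd2 /cl /zform /= => /andP [oa ob] hab /eqP q.
    have [k ek] : exists k : int, a + b = 8 * k by exists ((a + b) %/ 8)%Z; lia.
    have ec : a + 13 * b = 4 * (2 * k + 3 * b) by lia.
    have ed : 3 * b - a = 4 * (b - 2 * k) by lia.
    have -> : ((a + 13 * b) %/ 4 = 2 * k + 3 * b)%Z by lia.
    have -> : ((3 * b - a) %/ 4 = b - 2 * k)%Z by lia.
    split; last by congr pair; lia.
    apply/and3P; split; [lia | lia | ].
    by apply/eqP; rewrite -q (_ : a = 8 * k - b); [ring | lia].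
  move=> [c d] /and3P []; rewrite /odd2 /cl /zform /= => /andP [oc od] hcd /eqP q.
  have [k ek] : exists k : int, c - 3 * d = 8 * k by exists ((c - 3 * d) %/ 8)%Z; lia.
  have -> : ((3 * c - 13 * d) %/ 4 = 6 * k - d)%Z by lia.
  have -> : ((c + d) %/ 4 = 2 * k + d)%Z by lia.
  split; last by congr pair; lia.
  apply/and3P; split; [lia | lia | ].
  by apply/eqP; rewrite -q (_ : c = 8 * k + 3 * d); [ring | lia].
have E2 : S 1%N 39%N 3 = count (fun p => ((p.1 + p.2) %% 4 == 2)%Z && zform 12 52 n p) (zbox n).
  apply: (@count_zbox_bij n _ _ (fun p => ((p.1 + 13 * p.2) %/ 8, (3 * p.2 - p.1) %/ 8)%Z)
     (fun p => ((3 * p.1 - 13 * p.2) %/ 2, (p.1 + p.2) %/ 2)%Z)).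
  - by move=> x /and3P [_ _ /zform_box]; apply.
  - by move=> x /andP [_ /zform_box]; apply.
  - move=> [a b] /and3P []; rewrite /odd2 /cl /zform /= => /andP [oa ob] hab /eqP q.
    have [k ek] : exists k : int, a - 3 * b = 8 * k by exists ((a - 3 * b) %/ 8)%Z; lia.
    have -> : ((a + 13 * b) %/ 8 = k + 2 * b)%Z by lia.
    have -> : ((3 * b - a) %/ 8 = - k)%Z by lia.
    split; last by congr pair; lia.
    apply/andP; split; first lia.
    by apply/eqP; rewrite -q (_ : a = 8 * k + 3 * b); [ring | lia].
  move=> [c d] /andP []; rewrite /zform /= => hcd /eqP q.
  have [k ek] : exists k : int, c + d = 2 * k by exists ((c + d) %/ 2)%Z; lia.
  have -> : ((3 * c - 13 * d) %/ 2 = 3 * k - 8 * d)%Z by lia.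
  have -> : ((c + d) %/ 2 = k)%Z by lia.
  split; last by congr pair; lia.
  apply/and3P; rewrite /odd2 /cl /=; split; [lia | lia | ].
  by apply/eqP; rewrite -q (_ : c = 2 * k - d); [ring | lia].
have E3 : S 3%N 13%N 1 = count (fun p => ((p.1 + p.2) %% 4 == 2)%Z && zform 4 156 n p) (zbox n).
  apply: (@count_zbox_bij n _ _ (fun p => ((3 * p.1 + 13 * p.2) %/ 8, (p.1 - p.2) %/ 8)%Z)
     (fun p => ((p.1 + 13 * p.2) %/ 2, (p.1 - 3 * p.2) %/ 2)%Z)).
  - by move=> x /and3P [_ _ /zform_box]; apply.
  - by move=> x /andP [_ /zform_box]; apply.
  - move=> [a b] /and3P []; rewrite /odd2 /cl /zform /= => /andP [oa ob] hab /eqP q.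
    have [k ek] : exists k : int, a - b = 8 * k by exists ((a - b) %/ 8)%Z; lia.
    have -> : ((3 * a + 13 * b) %/ 8 = 3 * k + 2 * b)%Z by lia.
    have -> : ((a - b) %/ 8 = k)%Z by lia.
    split; last by congr pair; lia.
    apply/andP; split; first lia.
    by apply/eqP; rewrite -q (_ : a = 8 * k + b); [ring | lia].
  move=> [c d] /andP []; rewrite /zform /= => hcd /eqP q.
  have [k ek] : exists k : int, c - 3 * d = 2 * k by exists ((c - 3 * d) %/ 2)%Z; lia.
  have -> : ((c + 13 * d) %/ 2 = k + 8 * d)%Z by lia.
  have -> : ((c - 3 * d) %/ 2 = k)%Z by lia.
  split; last by congr pair; lia.
  apply/and3P; rewrite /odd2 /cl /=; split; [lia | lia | ].
  by apply/eqP; rewrite -q (_ : c = 2 * k + 3 * d); [ring | lia].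
have := splitS 3%N 13%N isT isT; have := splitS 1%N 39%N isT isT.
rewrite E1 E2 E3 !count_sum_2mod4 //.
rewrite -[(4 * 12)%N]/48%N -[(4 * 52)%N]/208%N -[(4 * 4)%N]/16%N -[(4 * 156)%N]/624%N.
have := evenS 3%N 13%N 3.
move: (S _ _ _) (mixed_reps _ _ _) (mixed_reps _ _ _) => x y z; lia.
Qed.

(** * Modular equations *)

Lemma natr_F2 n : n%:R = (odd n)%:R :> 'F_2.
Proof.
rewrite -[in LHS](odd_double_half n) natrD -addnn natrD addff2 addr0.
by case: (odd n).
Qed.

Lemma eq_char2 (f g h : fps 'F_2) : f = g + (h + h) -> f = g.
Proof. by rewrite addff addr0. Qed.

Lemma vser_id (R : comNzRingType) (f : fps R) : vser 1 f = f.
Proof. by apply: fpsP => n; rewrite fcoef_vser dvd1n divn1. Qed.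

Lemma fcoef_theta_sqr P a : fcoef (theta P) (a ^ 2) = (P a)%:R.
Proof.
rewrite fcoef_theta (bigD1 (inord a)) //= inordK ?eqxx ?andbT; last by nia.
rewrite big1 ?addn0 // => i /eqP ia; case: eqP => [e|_]; last by rewrite andbF.
case: ia; apply: val_inj; rewrite /= inordK; last by nia.
by move: (nat_of_ord i) e => j /eqP; rewrite eqn_sqr => /eqP.
Qed.

Lemma fcoef_theta_nsqr P m : (forall a, (a ^ 2)%N <> m) -> fcoef (theta P) m = 0.
Proof. by move=> nm; rewrite fcoef_theta big1 // => i _; case: eqP => [/nm|_]; rewrite ?andbF. Qed.

Lemma hecke_theta p P : prime p -> (forall a, P (p * a)%N = P a) -> hecke p (theta P) = 0.
Proof.
move=> pp Pp; apply: fpsP => n; rewrite heckeE fcoefD fcoef0 fcoef_user fcoef_vser.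
have p0 := prime_gt0 pp.
have [[s es]|ns] := pselect (exists s, (s ^ 2)%N = (p * n)%N).
  have : (p %| s ^ 2)%N by rewrite es dvdn_mulr.
  rewrite Euclid_dvdX // andbT => /dvdnP [t st].
  have en : n = (p * t ^ 2)%N.
    by apply/eqP; rewrite -(eqn_pmul2l p0) -es st expnMn mulnC; apply/eqP; ring.
  by rewrite -es fcoef_theta_sqr en dvdn_mulr // mulKn // fcoef_theta_sqr st mulnC Pp addff2.
rewrite fcoef_theta_nsqr ?add0r; last by move=> a ea; apply: ns; exists a.
case: ifP => // /dvdnP [k nk]; rewrite fcoef_theta_nsqr // => t et.
by apply: ns; exists (p * t)%N; rewrite expnMn et nk mulnK //; ring.
Qed.

Local Notation F := (theta odd).
Local Notation D := Dser.

Lemma Dser_theta : D = theta (coprime^~ 6).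
Proof.
apply: fpsP => m; rewrite fcoef_theta /= (big_mkcond (fun i => coprime i 6 && _)) /=.
rewrite -(big_mkord xpredT (fun a => nat_of_bool (coprime a 6 && (a ^ 2 == m)%N))).
rewrite [in RHS]big_ltn //= add0n natr_sum; apply: eq_bigr => i _.
by case: (_ && _).
Qed.

Lemma Dser_F : D = F + vser 9 F.
Proof.
rewrite Dser_theta; apply: fpsP => m; rewrite fcoefD fcoef_vser.
have [[s <-]|ns] := pselect (exists s, (s ^ 2)%N = m); last first.
  have ns' a : (a ^ 2)%N <> m by move=> e; apply: ns; exists a.
  rewrite !(@fcoef_theta_nsqr _ m) // add0r; case: ifP => // /dvdnP [k mk].
  by rewrite fcoef_theta_nsqr // => t et; apply: (ns' (3 * t)%N); rewrite expnMn et mk mulnK // mulnC.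
rewrite !fcoef_theta_sqr.
have -> : coprime s 6 = odd s && ~~ (3 %| s)%N.
  by rewrite -[6%N]/(2 * 3)%N coprimeMr coprime_sym coprime2n coprime_sym prime_coprime.
have -> : (9 %| s ^ 2)%N = (3 %| s)%N by rewrite -[9%N]/(3 ^ 2)%N dvdn_pexp2r.
case: (boolP (3 %| s)%N) => [/dvdnP [t ->]|_]; last by rewrite andbT addr0.
by rewrite expnMn mulnK // fcoef_theta_sqr oddM andbT andbF addff2.
Qed.

Definition low_zero (f : fps 'F_2) n := forall k, (k < n)%N -> fcoef f k = 0.
Definition lead (n : nat) (f : fps 'F_2) := low_zero f n /\ fcoef f n = 1.

Lemma leadM m n f g : lead m f -> lead n g -> lead (m + n) (f * g).
Proof.
move=> [f0 f1] [g0 g1]; have [H1 H2] := fcoefM_low f0 g0.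
by split=> //; rewrite H1 f1 g1 mulr1.
Qed.

Lemma leadX m k f : lead m f -> lead (m * k) (f ^+ k).
Proof.
move=> fm; elim: k => [|k IH]; first by rewrite muln0 expr0; split.
by rewrite mulnS exprS; apply: leadM.
Qed.

Lemma lead_neq0 n f : lead n f -> f != 0.
Proof. by move=> [_ f1]; apply/eqP => f0; move: f1; rewrite f0. Qed.

Lemma lead_vser p n f : (0 < p)%N -> lead n f -> lead (p * n) (vser p f).
Proof.
move=> p0 [f0 f1]; split=> [k kn|]; rewrite fcoef_vser; last by rewrite dvdn_mulr // mulKn.
by case: ifP => // /dvdnP [j kj]; rewrite kj mulnK // f0 //; move: kn; rewrite kj mulnC ltn_pmul2l.
Qed.

Lemma lead_D : lead 1 D.
Proof.
rewrite Dser_theta; split=> [[|k] //|]; last exact: (fcoef_theta_sqr _ 1).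
by rewrite (fcoef_theta_sqr _ 0).
Qed.

Lemma theta_eq_3 : F * vser 3 F = F ^+ 4 + vser 3 F ^+ 4.
Proof.
rewrite (exprf_vser 2 F) (exprf_vser 2 (vser 3 F)) vser_comp // -[(2 ^ 2 * 3)%N]/12%N -[(2 ^ 2)%N]/4%N.
apply: fpsP => n; rewrite -[X in X * _]vser_id odd_reps_fcoef // fcoefD !odd_sqr_reps_fcoef //.
by rewrite -natrD natr_F2 odd_reps_1_3 [RHS]natr_F2; congr (_%:R); lia.
Qed.

Lemma theta_eq_7 :
  F * vser 7 F = (F * vser 7 F) ^+ 2 + F ^+ 8 + vser 7 F ^+ 8.
Proof.
rewrite sqrf_vser vserM // (exprf_vser 3 F) (exprf_vser 3 (vser 7 F)) !vser_comp //.
rewrite -[(2 ^ 3 * 7)%N]/56%N -[(2 * 7)%N]/14%N -[(2 ^ 3)%N]/8%N.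
apply: fpsP => n; rewrite -[X in X * _]vser_id odd_reps_fcoef // !fcoefD odd_reps_fcoef // !odd_sqr_reps_fcoef //.
by rewrite -!natrD natr_F2 odd_reps_1_7 [RHS]natr_F2; congr (_%:R); lia.
Qed.

Lemma theta_eq_39 :
  let H := vser 3 F * vser 13 F + F * vser 39 F in
  H = H ^+ 4 + F ^+ 16 + vser 3 F ^+ 16 + vser 13 F ^+ 16 + vser 39 F ^+ 16.
Proof.
move=> H; rewrite /H (exprf_vser 2 (_ + _)) vserD !vserM //.
rewrite (exprf_vser 4 F) (exprf_vser 4 (vser 3 F)) (exprf_vser 4 (vser 13 F)) (exprf_vser 4 (vser 39 F)).
rewrite !vser_comp // -[X in _ + X * _ = _]vser_id.
rewrite -[(2 ^ 2 * 3)%N]/12%N -[(2 ^ 2 * 13)%N]/52%N -[(2 ^ 2 * 39)%N]/156%N -[(2 ^ 2)%N]/4%N.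
rewrite -[(2 ^ 4 * 3)%N]/48%N -[(2 ^ 4 * 13)%N]/208%N -[(2 ^ 4 * 39)%N]/624%N -[(2 ^ 4)%N]/16%N.
apply: fpsP => n; rewrite !fcoefD !odd_reps_fcoef // !odd_sqr_reps_fcoef //.
by rewrite -!natrD natr_F2 odd_reps_39 [RHS]natr_F2.
Qed.

Lemma D_neq0 : D != 0. Proof. exact: lead_neq0 lead_D. Qed.

(* D = F + V_9 F is a root of Y^4 = (V_3 F) Y, because F and V_9 F both satisfy
   the modular equation of level 3 over V_3 F. *)
Lemma D_cube : D ^+ 3 = vser 3 F.
Proof.
apply: (fps_mulfI D_neq0); rewrite -exprS Dser_F (exprfD2 2) mulrDl theta_eq_3.
have := congr1 (vser 3) theta_eq_3; rewrite vserD vserM // !vserX // vser_comp // mulrC => ->.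
by apply: (@eq_char2 _ _ (- vser 3 F ^+ 4)); ring.
Qed.

Lemma vser_D_cube p : (0 < p)%N -> vser p D ^+ 3 = vser 3 (vser p F).
Proof. by move=> p0; rewrite -vserX // D_cube !vser_comp // mulnC. Qed.

(** V_3 applied to [theta_eq_7] turns F into D^3. *)
Lemma modular_eq_7_cubed : let E := vser 7 D in
  D ^+ 24 + E ^+ 24 + D ^+ 3 * E ^+ 3 + D ^+ 6 * E ^+ 6 = 0.
Proof.
move=> E; have := congr1 (vser 3) theta_eq_7.
rewrite !vserD // !vserX // !vserM // -D_cube -vser_D_cube // -/E => H.
rewrite -[RHS](addff (D ^+ 3 * E ^+ 3)) [X in _ = _ + X]H; ring.
Qed.

(** In characteristic 2 the cubed equation factors as (s + w) (s^2 + w s + y^2). As D begins with x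
    and E with x^7, each of s, y, w begins with x^8; so the second factor has coefficient 1 + 1 + 1
    at x^16 and is nonzero. *)
Lemma modular_eq_7 : let E := vser 7 D in
  D ^+ 8 + E ^+ 8 + D * E + D ^+ 4 * E ^+ 4 = 0.
Proof.
move=> E; set s := D ^+ 8 + E ^+ 8; set y := D * E; set w := y + y ^+ 4.
have yw : D ^+ 4 * E ^+ 4 = y ^+ 4 by rewrite exprMn.
have [|C0] : s + w = 0 \/ s ^+ 2 + w * s + y ^+ 2 = 0; last 2 first.
- by move=> sw; rewrite yw -addrA.
- have lE : lead 7 E by rewrite -[7%N]/(7 * 1)%N; apply/lead_vser/lead_D.
  have ly : lead 8 y by exact: (leadM lead_D lE).
  have ls : lead 8 s.
    have [l8 c8] := leadX 8 lead_D; have [m8 _] := leadX 8 lE.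
    by split=> [k k8|]; rewrite fcoefD ?c8 ?l8 ?m8 ?addr0 //; lia.
  have lw : lead 8 w.
    have [l8 c8] := ly; have [m8 _] := leadX 4 ly.
    by split=> [k k8|]; rewrite fcoefD ?c8 ?l8 ?m8 ?addr0 //; lia.
  have := congr1 (fun f => fcoef f 16) C0; rewrite !fcoefD fcoef0.
  by rewrite (leadX 2 ls).2 (leadX 2 ly).2 (leadM lw ls).2 addff2 add0r => /eqP; rewrite oner_eq0.
apply: fps_mulf_eq0; rewrite -[RHS]modular_eq_7_cubed -/E.
apply: (@eq_char2 _ _ (2 * y ^+ 8 * s + w * s ^+ 2 + (y ^+ 2 + y ^+ 5) * s)).
by rewrite /s /w /y; ring.
Qed.

(* The exponents are kept abstract here, and the series in the next lemma:
   comparing two unequal concrete powers by unfolding takes exponential time. *)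
Lemma vser_sum_powers p m n (h a b c d : fps 'F_2) : (0 < p)%N ->
  vser p (h ^+ m + a ^+ n + b ^+ n + c ^+ n + d ^+ n) =
  vser p h ^+ m + vser p a ^+ n + vser p b ^+ n + vser p c ^+ n + vser p d ^+ n.
Proof. by move=> p0; rewrite !vserD !vserX. Qed.

Lemma level_39_combination (a b c d e f h k : fps 'F_2) :
  h = b * c + a * d -> k = e * d + b * f ->
  h = h ^+ 4 + a ^+ 16 + b ^+ 16 + c ^+ 16 + d ^+ 16 ->
  k = k ^+ 4 + b ^+ 16 + e ^+ 16 + d ^+ 16 + f ^+ 16 ->
  b = (a + e) ^+ 3 -> d = (c + f) ^+ 3 ->
  (a + e) ^+ 16 + (c + f) ^+ 16 + (a + e) ^+ 12 * (c + f) ^+ 4 +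
  (a + e) ^+ 4 * (c + f) ^+ 12 + (a + e) ^+ 3 * (c + f) + (a + e) * (c + f) ^+ 3 = 0.
Proof.
move=> hE kE hr kr bE dE.
have S : (a + e) ^+ 3 * (c + f) + (a + e) * (c + f) ^+ 3 = h + k.
  by rewrite -bE -dE hE kE; ring.
have S4 : (a + e) ^+ 12 * (c + f) ^+ 4 + (a + e) ^+ 4 * (c + f) ^+ 12 = h ^+ 4 + k ^+ 4.
  move: S (exprfD2 2 h k) => <-; rewrite (exprfD2 2 (_ * _)) -[(2 ^ 2)%N]/4%N => <-.
  by move: (a + e) (c + f) => u v; ring.
rewrite -[LHS]addrA S -[X in X + _]addrA S4 (exprfD2 4 a e) (exprfD2 4 c f).
rewrite -[(2 ^ 4)%N]/16%N; move: hr kr {hE kE S S4 bE dE}.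
move: (h ^+ 4) (k ^+ 4) (a ^+ 16) (b ^+ 16) (c ^+ 16) (d ^+ 16) (e ^+ 16) (f ^+ 16)
  => h4 k4 {}a {}b {}c {}d {}e {}f -> ->.
by apply: (@eq_char2 _ _ (a + b + c + d + e + f + h4 + k4)); ring.
Qed.

(** Add [theta_eq_39] to its image under V_3. The 16th powers of V_3 F = D^3 and V_39 F = E^3 occur
    twice and cancel, the others combine to D^16 + E^16, and the products combine to D^3 E + D
    E^3. *)
Lemma modular_eq_13 : let E := vser 13 D in
  D ^+ 16 + E ^+ 16 + D ^+ 12 * E ^+ 4 + D ^+ 4 * E ^+ 12 + D ^+ 3 * E + D * E ^+ 3 = 0.
Proof.
have eq39 := theta_eq_39; rewrite /= in eq39.
have := congr1 (vser 3) eq39; rewrite (vser_sum_powers 4 16) //.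
rewrite !vserD !vserM // !vser_comp // => eq39_3.
have E : vser 13 D = vser 13 F + vser 117 F by rewrite Dser_F vserD vser_comp.
have d3 : vser 39 F = (vser 13 F + vser 117 F) ^+ 3 by rewrite -E vser_D_cube // vser_comp.
have f3 := D_cube; rewrite /= E Dser_F; rewrite Dser_F in f3.
exact: (level_39_combination (erefl _) (erefl _) eq39 eq39_3 (esym f3) d3).
Qed.

(** * Recursions for the traces *)

Lemma hecke_vser p q f : (0 < p)%N -> (0 < q)%N -> coprime p q ->
  hecke p (vser q f) = vser q (hecke p f).
Proof.
move=> p0 q0 pq; rewrite !heckeE vserD !vser_comp // (mulnC p).
by rewrite (@vser_user_comm _ q p) // coprime_sym.
Qed.

Section Base.
Variable p : nat.
Hypotheses (p_prime : prime p) (p_gt3 : (3 < p)%N).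

Let cop q : prime q -> (q <= 3)%N -> coprime p q.
Proof.
move=> pq q3; rewrite prime_coprime // dvdn_prime2 //; apply/eqP => e.
by move: q3; rewrite -e leqNgt p_gt3.
Qed.

Lemma hecke_D1 : hecke p D = 0.
Proof.
rewrite Dser_theta hecke_theta // => a /=.
by rewrite coprimeMl (coprimeMr p 2 3) !cop.
Qed.

Lemma hecke_D3 : hecke p (D ^+ 3) = 0.
Proof.
have p0 : (0 < p)%N by exact: prime_gt0.
rewrite D_cube hecke_vser // ?cop // hecke_theta ?vser0 // => a.
have := cop (isT : prime 2) isT; rewrite coprimen2 => op.
by rewrite oddM op.
Qed.

Lemma hecke_D_double k : hecke p (D ^+ (2 * k)) = hecke p (D ^+ k) ^+ 2.
Proof. by rewrite mulnC exprM hecke_sqr //; have := cop (isT : prime 2) isT; rewrite coprimen2. Qed.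
End Base.

(** The last hypothesis makes the equation symmetric, so that it provides both relations required by
    [hecke_rec]. *)
Lemma hecke_monic_rec p (f : fps 'F_2) n (L : seq (nat * nat)) k : (0 < p)%N ->
  f ^+ n + vser p f ^+ n + \sum_(ab <- L) f ^+ ab.1 * vser p f ^+ ab.2 = 0 ->
  \sum_(ab <- L) f ^+ ab.2 * vser p f ^+ ab.1 = \sum_(ab <- L) f ^+ ab.1 * vser p f ^+ ab.2 ->
  hecke p (f ^+ (k + n)) =
  f ^+ n * hecke p (f ^+ k) + \sum_(ab <- L) f ^+ ab.1 * hecke p (f ^+ (k + ab.2)).
Proof.
move=> p0 e sym; apply: addff_eq0.
have := @hecke_rec p f [:: (0, n), (n, 0) & L]%N k p0.
rewrite !big_cons /= !expr0 !mulr1 !mul1r addn0; apply.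
  by rewrite -[RHS]e addrCA addrA.
by rewrite -[RHS]e sym addrA.
Qed.

Lemma hecke7_rec k :
  hecke 7 (D ^+ (k + 8)) = D ^+ 8 * hecke 7 (D ^+ k) + (D * hecke 7 (D ^+ (k + 1))
   + D ^+ 4 * hecke 7 (D ^+ (k + 4))).
Proof.
have E8 a b (c d : fps 'F_2) : \sum_(ab <- [:: (1, 1); (a, b)]%N) c ^+ ab.1 * d ^+ ab.2 = c * d + c ^+ a * d ^+ b.
  by rewrite !big_cons big_nil addr0 /= !expr1.
rewrite (@hecke_monic_rec 7 D 8 [:: (1, 1); (4, 4)]%N) //.
  by rewrite !big_cons big_nil addr0 /= expr1.
  by rewrite E8 !addrA; exact: modular_eq_7.
by rewrite !big_cons !big_nil.
Qed.

Lemma hecke13_rec k :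
  hecke 13 (D ^+ (k + 16)) = D ^+ 16 * hecke 13 (D ^+ k) + (D ^+ 12 * hecke 13 (D ^+ (k + 4))
   + (D ^+ 4 * hecke 13 (D ^+ (k + 12)) + (D ^+ 3 * hecke 13 (D ^+ (k + 1))
   + D * hecke 13 (D ^+ (k + 3))))).
Proof.
have E4 a b x (c d : fps 'F_2) : \sum_(ab <- [:: (a, b); (b, a); (x, 1); (1, x)]%N) c ^+ ab.1 * d ^+ ab.2 =
    c ^+ a * d ^+ b + (c ^+ b * d ^+ a + (c ^+ x * d + c * d ^+ x)).
  by rewrite !big_cons big_nil addr0 /= !expr1.
have sym a b x (c d : fps 'F_2) : \sum_(ab <- [:: (a, b); (b, a); (x, 1); (1, x)]%N) c ^+ ab.2 * d ^+ ab.1 =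
    \sum_(ab <- [:: (a, b); (b, a); (x, 1); (1, x)]%N) c ^+ ab.1 * d ^+ ab.2.
  by rewrite !big_cons !big_nil !addr0 /= !expr1; ring.
rewrite (@hecke_monic_rec 13 D 16 [:: (12, 4); (4, 12); (3, 1); (1, 3)]%N) //.
  by rewrite !big_cons big_nil addr0 /= expr1.
  by rewrite E4 !addrA; exact: modular_eq_13.
Qed.

(* In W5 only the powers of D^6 matter; here q may be any power of 2. *)
Lemma hecke7_rec48 s k : let q := (2 ^ s)%N in
  hecke 7 (D ^+ (k + 48 * q)) = D ^+ (48 * q) * hecke 7 (D ^+ k)
   + (D ^+ (6 * q) * hecke 7 (D ^+ (k + 6 * q)) + D ^+ (12 * q) * hecke 7 (D ^+ (k + 12 * q))).
Proof.
move=> q.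
have e : D ^+ (48 * q) + vser 7 D ^+ (48 * q) + (D ^+ (6 * q) * vser 7 D ^+ (6 * q)
   + D ^+ (12 * q) * vser 7 D ^+ (12 * q)) = 0.
  (* The power 2^(s+1) of the cubed equation: one squaring turns the exponents 24, 3, 6 into
     multiples of 6, and s more multiply them by q. *)
  have := modular_eq_7_cubed; rewrite /=.
  have -> : (48 * q = 24 * 2 ^ s.+1)%N by rewrite /q expnS; lia.
  have -> : (6 * q = 3 * 2 ^ s.+1)%N by rewrite /q expnS; lia.
  have -> : (12 * q = 6 * 2 ^ s.+1)%N by rewrite /q expnS; lia.
  rewrite addrA; move: {q} s.+1 24%N 3%N 6%N D (vser 7 D) => t a b c d E.
  by rewrite !exprM -!exprMn -!exprfD2 => ->; rewrite expr0n expn_eq0.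
move: {e} (48 * q)%N (6 * q)%N (12 * q)%N e => n a b e.
rewrite (@hecke_monic_rec 7 D n [:: (a, a); (b, b)]) ?big_cons ?big_nil ?addr0 //=.
Qed.

Lemma trace13_elimination (d a b c e : fps 'F_2) : d != 0 -> fcoef d 0 = 0 ->
  c ^+ 2 = d ^+ 4 * b ^+ 2 + d * a ->
  a ^+ 4 = d ^+ 3 * a + d * b ->
  e ^+ 2 = d ^+ 12 * a ^+ 2 + d ^+ 4 * c ^+ 2 + d ^+ 3 * b + d * c ->
  d ^+ 4 * a ^+ 4 + d ^+ 3 * c + d * e = 0 ->
  [/\ a = 0, b = 0, c = 0 & e = 0].
Proof.
move=> d0 dc E2 E4 E6 E8.
have db : d * b = a ^+ 4 + d ^+ 3 * a by rewrite E4 addrAC addff add0r.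
have de : d * e = d ^+ 4 * a ^+ 4 + d ^+ 3 * c by rewrite [RHS](addff_eq0 E8).
have d3 : d ^+ 3 != 0 by apply/eqP => /fps_expf_eq0 /eqP; rewrite (negbTE d0).
pose M := d ^+ 5 * a ^+ 8 + d ^+ 11 * a ^+ 2 + d * a ^+ 4 + d ^+ 4 * a.
have cM : c = M.
  apply: (fps_mulfI d3); apply: addff_eq0.
  have : d ^+ 2 * e ^+ 2 = d ^+ 14 * a ^+ 2 + d ^+ 6 * c ^+ 2 + d ^+ 4 * (d * b) + d ^+ 3 * c.
    by rewrite E6; ring.
  rewrite -exprMn de sqrfD db => H.
  have := addff ((d ^+ 4 * a ^+ 4) ^+ 2 + (d ^+ 3 * c) ^+ 2); rewrite [X in _ + X]H => <-.
  by apply: (@eq_char2 _ _ (- (d ^+ 6 * c ^+ 2))); rewrite /M; ring.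
have H : d ^+ 3 * (a * (d * (d ^+ 8 * a ^+ 15 + d ^+ 20 * a ^+ 3) + 1)) = 0.
  have : d ^+ 2 * c ^+ 2 = d ^+ 4 * (d * b) ^+ 2 + d ^+ 3 * a by rewrite E2; ring.
  rewrite db cM /M !sqrfD => H; rewrite -[RHS](addff (d ^+ 2 * ((d ^+ 5 * a ^+ 8) ^+ 2 +
    (d ^+ 11 * a ^+ 2) ^+ 2 + (d * a ^+ 4) ^+ 2 + (d ^+ 4 * a) ^+ 2))) [X in _ = _ + X]H.
  by apply: (@eq_char2 _ _ (- (d ^+ 4 * a ^+ 8 + d ^+ 10 * a ^+ 2))); ring.
have a0 : a = 0.
  case: (fps_mulf_eq0 H) => [/eqP|/fps_mulf_eq0 [//|/(congr1 (fun f => fcoef f 0))]].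
    by rewrite (negbTE d3).
  by rewrite fcoefD fcoef0 fcoef1 fcoefM big_ord1 dc mul0r add0r => /eqP; rewrite oner_eq0.
have dd x : d * x = 0 -> x = 0 by case/fps_mulf_eq0 => // /eqP; rewrite (negbTE d0).
split=> //.
- by apply: dd; rewrite db a0 expr0n mulr0 addr0.
- by rewrite cM /M a0 !expr0n !mulr0 !addr0.
apply: dd; rewrite de a0 cM /M a0 !expr0n !mulr0 !addr0 !mulr0 addr0 //.
Qed.

Section SmallTraces.
(* t stands for k |-> hecke p (D ^+ k). *)
Variables (d : fps 'F_2) (t : nat -> fps 'F_2).
Hypotheses (d_lead : lead 1 d) (t0 : t 0 = 0) (t1 : t 1 = 0) (t3 : t 3 = 0).
Hypothesis dbl : forall k, t (2 * k) = t k ^+ 2.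

Let dbl0 k : t k = 0 -> t (2 * k) = 0.
Proof. by rewrite dbl => ->; rewrite expr0n. Qed.

Let idem_trace k : fcoef (t k) 1 = 1 -> t k ^+ 2 = d * t k -> t k = d.
Proof.
move=> c1; rewrite expr2 [d * _]mulrC; apply: fps_mulfI.
by apply/eqP => tk0; move: c1; rewrite tk0.
Qed.

(** The odd exponents 5 and 7 are reached through their doubles, which the recursion reduces to
    smaller exponents. For 7 this leaves t7^2 = d t7, with solutions 0 and d, and the coefficient of
    x decides. *)
Lemma small_traces7 :
  (forall k, t (k + 8) = d ^+ 8 * t k + (d * t (k + 1) + d ^+ 4 * t (k + 4))) ->
  fcoef (t 7) 1 = 1 ->
  forall k, (k < 8)%N -> t k = if (k == 7)%N then d else 0.
Proof.
move=> rec c7.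
have t2 := dbl0 t1; have t4 := dbl0 t2; have t6 := dbl0 t3.
have t5 : t 5 = 0.
  apply: (@fps_expf_eq0 _ _ 2); rewrite -dbl -[(2 * 5)%N]/(2 + 8)%N rec.
  by rewrite [t (2 + 1)]t3 [t (2 + 4)]t6 [t 2]t2 !mulr0 !addr0.
have t7 : t 7 = d.
  apply: idem_trace => //; rewrite -dbl -[(2 * 7)%N]/(6 + 8)%N rec.
  by rewrite [t (6 + 4)](dbl0 t5) [t 6]t6 !mulr0 addr0 add0r.
by case=> [|[|[|[|[|[|[|[|k]]]]]]]].
Qed.

Lemma small_traces13 :
  (forall k, t (k + 16) = d ^+ 16 * t k + (d ^+ 12 * t (k + 4)
   + (d ^+ 4 * t (k + 12) + (d ^+ 3 * t (k + 1) + d * t (k + 3))))) ->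
  fcoef (t 13) 1 = 1 ->
  forall k, (k < 16)%N -> t k = if (k == 13)%N then d else if (k == 15)%N then d ^+ 3 else 0.
Proof.
move=> rec c13; have d0 := lead_neq0 d_lead.
(* The powers of d become variables, so that unification cannot unfold them. *)
have [d3 e3] : exists x, x = d ^+ 3 by exists (d ^+ 3).
have [d4 e4] : exists x, x = d ^+ 4 by exists (d ^+ 4).
have [d12 e12] : exists x, x = d ^+ 12 by exists (d ^+ 12).
move: (d ^+ 16) rec; rewrite -e3 -e4 -e12 => d16 rec.
have t2 := dbl0 t1; have t4 := dbl0 t2; have t8 := dbl0 t4; have t16 := dbl0 t8.
have t6 := dbl0 t3; have t12 := dbl0 t6; have t24 := dbl0 t12.
have [t5 t7 t9 t11] : [/\ t 5 = 0, t 7 = 0, t 9 = 0 & t 11 = 0].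
  apply: (trace13_elimination d0); rewrite -?e3 -?e4 -?e12; first by case: d_lead => /(_ 0%N isT).
  - rewrite -dbl -[(2 * 9)%N]/(2 + 16)%N rec [t 2]t2 [t (2 + 4)]t6 [t (2 + 12)](dbl 7).
    by rewrite [t (2 + 1)]t3 !mulr0 !add0r.
  - have -> : t 5 ^+ 4 = t 20 by rewrite [t 20](dbl 10) [t 10](dbl 5) -exprM.
    rewrite -[20%N]/(4 + 16)%N rec [t 4]t4 [t (4 + 4)]t8 [t (4 + 12)]t16.
    by rewrite !mulr0 !add0r.
  - rewrite -[t 11 ^+ 2]dbl -[(2 * 11)%N]/(6 + 16)%N rec [t 6]t6 [t (6 + 4)](dbl 5) [t (6 + 12)](dbl 9).
    by rewrite mulr0 add0r !addrA.
  have -> : t 5 ^+ 4 = t 20 by rewrite [t 20](dbl 10) [t 10](dbl 5) -exprM.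
  have := rec 8; rewrite [t (8 + 16)]t24 [t 8]t8 [t (8 + 4)]t12 !mulr0 !add0r => e.
  by rewrite -addrA; exact: esym e.
have t13 : t 13 = d.
  apply: idem_trace => //; rewrite -dbl -[(2 * 13)%N]/(10 + 16)%N rec.
  rewrite [t 10](dbl0 t5) [t (10 + 4)](dbl0 t7) [t (10 + 12)](dbl0 t11) [t (10 + 1)]t11.
  by rewrite !mulr0 !add0r.
(* The recursion at k = 12: since t 28 = t 7 ^ 4 = 0, it leaves d^3 t 13 = d t 15. *)
have t15 : t 15 = d3.
  apply: (fps_mulfI d0); apply/esym/addff_eq0; have := rec 12.
  rewrite [t (12 + 16)](dbl0 (dbl0 t7)) [t 12]t12 [t (12 + 4)]t16 [t (12 + 12)]t24 [t (12 + 1)]t13.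
  by rewrite !mulr0 !add0r [d3 * d]mulrC => <-.
by case=> [|[|[|[|[|[|[|[|[|[|[|[|[|[|[|[|k]]]]]]]]]]]]]]]] //= _; rewrite ?(dbl0 t5) ?(dbl0 t7).
Qed.
End SmallTraces.

Lemma hecke_D_coef1 p : (1 < p)%N -> fcoef (hecke p (D ^+ p)) 1 = 1.
Proof.
move=> p1; rewrite heckeE fcoefD fcoef_user fcoef_vser muln1 dvdn1 gtn_eqF // addr0.
by have [_] := leadX p lead_D; rewrite mul1n.
Qed.

Lemma hecke7_D_small k : (k < 8)%N -> hecke 7 (D ^+ k) = if (k == 7)%N then D else 0.
Proof.
move: k; apply: (@small_traces7 D (fun k => hecke 7 (D ^+ k))).
- by rewrite expr0 hecke1.
- by rewrite expr1 hecke_D1.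
- by rewrite hecke_D3.
- by move=> k; exact: hecke_D_double.
- exact: hecke7_rec.
- exact: hecke_D_coef1.
Qed.

Lemma hecke13_D_small k : (k < 16)%N ->
  hecke 13 (D ^+ k) = if (k == 13)%N then D else if (k == 15)%N then D ^+ 3 else 0.
Proof.
move: k; apply: (@small_traces13 D (fun k => hecke 13 (D ^+ k)) lead_D).
- by rewrite expr0 hecke1.
- by rewrite expr1 hecke_D1.
- by rewrite hecke_D3.
- by move=> k; exact: hecke_D_double.
- exact: hecke13_rec.
- exact: hecke_D_coef1.
Qed.

(** * Leading terms of the traces *)

(** Repetitions in the list are allowed, so that addition is concatenation; multiplicities count
    modulo 2. *)
Definition Dspan (P : pred nat) (f : fps 'F_2) :=
  exists2 l : seq nat, all P l & f = \sum_(e <- l) D ^+ e.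

Lemma Dspan0 P : Dspan P 0.
Proof. by exists [::]; rewrite ?big_nil. Qed.

Lemma Dspan_pow (P : pred nat) e : P e -> Dspan P (D ^+ e).
Proof. by move=> Pe; exists [:: e]; rewrite ?big_seq1 //= Pe. Qed.

Lemma DspanD P f g : Dspan P f -> Dspan P g -> Dspan P (f + g).
Proof.
move=> [l Pl ->] [m Pm ->]; exists (l ++ m); first by rewrite all_cat Pl.
by rewrite big_cat.
Qed.

Lemma Dspan_mulX (P Q : pred nat) a f : (forall e, P e -> Q (a + e)%N) ->
  Dspan P f -> Dspan Q (D ^+ a * f).
Proof.
move=> PQ [l Pl ->]; exists [seq (a + e)%N | e <- l].
  by rewrite all_map; apply: sub_all Pl => e /PQ.
by rewrite big_map mulr_sumr; apply: eq_bigr => e _; rewrite exprD.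
Qed.

Lemma Dspan_sub (P Q : pred nat) f : subpred P Q -> Dspan P f -> Dspan Q f.
Proof. by move=> PQ [l Pl ->]; exists l => //; apply: sub_all Pl. Qed.

Definition parity_norm (l : seq nat) := [seq e <- undup l | odd (count_mem e l)].

Lemma sum_parity_norm (g : nat -> fps 'F_2) l :
  \sum_(e <- parity_norm l) g e = \sum_(e <- l) g e.
Proof.
rewrite -[RHS]big_undup_iterop_count /= big_filter big_mkcond /=; apply: eq_bigr => e _.
rewrite -[RHS]/(g e *+ count_mem e l) -[in RHS](odd_double_half (count_mem e l)).
rewrite mulrnDr -addnn mulrnDr addff addr0; by case: (odd _).
Qed.

(** [hecke7_rec] on lists of exponents: it makes the base cases of the leading term computable. *)
Definition table7_step (s : seq (seq nat)) : seq (seq nat) :=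
  let n := size s in
  rcons s (if (n < 8)%N then (if n == 7%N then [:: 1%N] else [::])
    else parity_norm ([seq (8 + e)%N | e <- nth [::] s (n - 8)]
       ++ [seq (1 + e)%N | e <- nth [::] s (n - 7)]
       ++ [seq (4 + e)%N | e <- nth [::] s (n - 4)])).
Definition table7 n := iter n table7_step [::].

Lemma size_table7 n : size (table7 n) = n.
Proof. by elim: n => //= n IH; rewrite size_rcons IH. Qed.

Lemma table7P n i : (i < n)%N ->
  hecke 7 (D ^+ i) = \sum_(e <- nth [::] (table7 n) i) D ^+ e.
Proof.
elim: n i => // n IH i; rewrite ltnS leq_eqVlt => /predU1P [->{i}|lt]; last first.
  by rewrite /= nth_rcons size_table7 lt IH.
rewrite /= nth_rcons size_table7 ltnn eqxx.
have [n8|n8] := ltnP n 8.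
  rewrite hecke7_D_small //; case: eqP => _; last by rewrite big_nil.
  by rewrite big_seq1 expr1.
have e : (n = (n - 8) + 8)%N by rewrite subnK.
rewrite sum_parity_norm !big_cat !big_map /= [in LHS]e hecke7_rec.
have -> : (n - 8 + 1 = n - 7)%N by lia.
have -> : (n - 8 + 4 = n - 4)%N by lia.
rewrite !IH ?mulr_sumr; [|lia..].
by congr (_ + (_ + _)); apply: eq_bigr => x _; rewrite exprD ?expr1.
Qed.

(** A term D^a T_7(D^(k+b)) of the recursion has a + b = 8 or 2, so a + b <= 8 and a + b = 8 mod 6.
    For T_13 the sums are 16 and 4 against 16. *)
Lemma hecke7_Dspan k : Dspan (fun e => (e < k)%N && (e %% 6 == k %% 6)%N) (hecke 7 (D ^+ k)).
Proof.
have [n] := ubnP k; elim: n k => // n IH k kn.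
have [k8|k8] := ltnP k 8.
  rewrite hecke7_D_small //; case: eqP => [->|_]; last exact: Dspan0.
  by rewrite -[X in Dspan _ X]expr1; apply: Dspan_pow.
have e : (k = (k - 8) + 8)%N by rewrite subnK.
rewrite [in X in Dspan _ X]e hecke7_rec.
apply: DspanD; last apply: DspanD; last 1 first.
- by apply: Dspan_mulX (IH _ _) => [x|]; lia.
- by apply: Dspan_mulX (IH _ _) => [x|]; lia.
by rewrite -[X in X * _]expr1; apply: Dspan_mulX (IH _ _) => [x|]; lia.
Qed.

Lemma hecke13_Dspan k : Dspan (fun e => (e < k)%N && (e %% 6 == k %% 6)%N) (hecke 13 (D ^+ k)).
Proof.
have [n] := ubnP k; elim: n k => // n IH k kn.
have [k8|k8] := ltnP k 16.
  rewrite hecke13_D_small //; case: eqP => [->|_].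
    by rewrite -[X in Dspan _ X]expr1; apply: Dspan_pow.
  by case: eqP => [->|_]; [apply: Dspan_pow | exact: Dspan0].
have e : (k = (k - 16) + 16)%N by rewrite subnK.
rewrite [in X in Dspan _ X]e hecke13_rec.
apply: DspanD; [|apply: DspanD; [|apply: DspanD; [|apply: DspanD]]]; try by apply: Dspan_mulX (IH _ _) => [x|]; lia.
by rewrite -[X in X * _]expr1; apply: Dspan_mulX (IH _ _) => [x|]; lia.
Qed.

(** * Binary digits in even and odd positions, and the weight *)

Section Digits.

(* spread n is the number whose digits in base 4 are the binary digits of n; f is fuel. *)
Fixpoint spread_rec f n := if f is f'.+1 then (odd n + 4 * spread_rec f' n./2)%N else 0%N.
Definition spread n := spread_rec n n.

Fixpoint even_bits_rec f n := if f is f'.+1 then (odd n + 2 * even_bits_rec f' (n %/ 4))%N else 0%N.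
Definition even_bits n := even_bits_rec n n.

Lemma spread_rec_fuel f g n : (n <= f)%N -> (n <= g)%N -> spread_rec f n = spread_rec g n.
Proof.
have rec0 h : spread_rec h 0 = 0%N by elim: h => //= h ->.
elim: f g n => [|f IH] [|g] n nf ng /=.
- by [].
- by move: nf; rewrite leqn0 => /eqP ->; rewrite rec0.
- by move: ng; rewrite leqn0 => /eqP ->; rewrite rec0.
by rewrite (IH g); lia.
Qed.

Lemma spreadE n : spread n = (odd n + 4 * spread n./2)%N.
Proof. by case: n => [|n] //; rewrite {1}/spread [LHS]/= (@spread_rec_fuel n n.+1./2) //; lia. Qed.

Lemma even_bits_rec_fuel f g n :
  (n <= f)%N -> (n <= g)%N -> even_bits_rec f n = even_bits_rec g n.
Proof.
have rec0 h : even_bits_rec h 0 = 0%N by elim: h => //= h ->.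
elim: f g n => [|f IH] [|g] n nf ng; rewrite [LHS]/= [RHS]/=.
- by [].
- by move: nf; rewrite leqn0 => /eqP ->; rewrite rec0.
- by move: ng; rewrite leqn0 => /eqP ->; rewrite rec0.
by rewrite (IH g); lia.
Qed.

Lemma even_bitsE n : even_bits n = (odd n + 2 * even_bits (n %/ 4))%N.
Proof. by case: n => [|n] //; rewrite {1}/even_bits [LHS]/= (@even_bits_rec_fuel n (n.+1 %/ 4)) //; lia. Qed.

(** It serves twice: for the coordinates of D^(6n+5), and as a bijection of pairs with numbers that
    enumerates the monomials X^i Y^j. *)
Definition interleave i j := (spread i + 2 * spread j)%N.

Lemma even_bits_digit m d : (d < 4)%N -> even_bits (4 * m + d) = (odd d + 2 * even_bits m)%N.
Proof.
move=> d4; rewrite even_bitsE; have -> : ((4 * m + d) %/ 4 = m)%N by lia.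
by congr (nat_of_bool _ + _)%N; lia.
Qed.

Lemma interleaveE i j :
  interleave i j = (4 * interleave i./2 j./2 + (odd i + 2 * odd j))%N.
Proof. rewrite /interleave spreadE (spreadE j); lia. Qed.

Lemma even_bits_interleave i j : even_bits (interleave i j) = i.
Proof.
have [n] := ubnP (i + j); elim: n i j => // n IH i j ij.
case: (posnP (i + j)) => [|pos]; first by case: i j {ij} => [|i] [|j].
rewrite interleaveE even_bits_digit ?IH; lia.
Qed.

Lemma odd_bits_interleave i j : even_bits (interleave i j)./2 = j.
Proof.
have [n] := ubnP (i + j); elim: n i j => // n IH i j ij.
case: (posnP (i + j)) => [|pos]; first by case: i j {ij} => [|i] [|j].
rewrite interleaveE.
have -> : ((4 * interleave i./2 j./2 + (odd i + 2 * odd j))./2 =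
  4 * (interleave i./2 j./2)./2 + (odd j + 2 * odd (interleave i./2 j./2)))%N by lia.
by rewrite even_bits_digit ?IH; lia.
Qed.

Lemma interleave_bits n : interleave (even_bits n) (even_bits n./2) = n.
Proof.
have [k] := ubnP n; elim: k n => // k IH n nk.
case: (posnP n) => [-> //|pos].
rewrite interleaveE (even_bitsE n) (even_bitsE n./2).
have -> : ((odd n + 2 * even_bits (n %/ 4))./2 = even_bits (n %/ 4))%N by lia.
have -> : ((odd n./2 + 2 * even_bits (n./2 %/ 4))./2 = even_bits (n %/ 4)./2)%N.
  by rewrite (_ : (n./2 %/ 4 = (n %/ 4)./2)%N); lia.
by rewrite IH; lia.
Qed.

(* The weight 2 i + 3 j of the element with coordinates (i, j); the coefficients
   are such that a carry in either kind of digit strictly decreases it. *)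
Definition weight n := (2 * even_bits n + 3 * even_bits n./2)%N.

Lemma weight_interleave i j : weight (interleave i j) = (2 * i + 3 * j)%N.
Proof. by rewrite /weight even_bits_interleave odd_bits_interleave. Qed.

Lemma weight_digit m d : (d < 4)%N ->
  weight (4 * m + d) = (2 * odd d + 3 * odd d./2 + 2 * weight m)%N.
Proof.
move=> d4; rewrite /weight even_bits_digit //.
have -> : ((4 * m + d)./2 = 4 * m./2 + (odd d./2 + 2 * odd m))%N by lia.
rewrite even_bits_digit; last by lia.
by rewrite (_ : odd (odd d./2 + 2 * odd m) = odd d./2); lia.
Qed.

(** Two digits 4^l, of weight 2 * 2^l each, carry into 2 * 4^l of weight 3 * 2^l; two digits 2 *
    4^l, of weight 3 * 2^l each, carry into 4^(l+1) of weight 4 * 2^l. *)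
Lemma weightD a b : (weight (a + b) <= weight a + weight b)%N.
Proof.
have [n] := ubnP (a + b); elim: n a b => // n IH a b ab.
case: (posnP (a + b)) => [|pos]; first by case: a b {ab} => [|a] [|b].
have ea : a = (4 * (a %/ 4) + a %% 4)%N by lia.
have eb : b = (4 * (b %/ 4) + b %% 4)%N by lia.
move: (a %/ 4)%N (b %/ 4)%N (a %% 4)%N (b %% 4)%N (ltn_pmod a (isT : 0 < 4)%N)
  (ltn_pmod b (isT : 0 < 4)%N) ea eb => A B d e d4 e4 ea eb.
have es : (a + b = 4 * (A + B + (d + e) %/ 4) + (d + e) %% 4)%N by lia.
rewrite es ea eb !weight_digit //; last by rewrite ltn_mod.
have := IH A B; have := IH (A + B)%N ((d + e) %/ 4)%N.
have w0 : weight 0 = 0%N by []. have w1 : weight 1 = 2%N by [].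
case: d e d4 e4 ea eb es => [|[|[|[|//]]]] [|[|[|[|//]]]] _ _ ea eb es /=;
  rewrite ?w0 ?w1; lia.
Qed.

Lemma spread_double n : spread n.*2 = (4 * spread n)%N.
Proof. by rewrite spreadE odd_double doubleK. Qed.

Lemma spread_exp2 u : spread (2 ^ u) = (4 ^ u)%N.
Proof. by elim: u => // u IH; rewrite expnS mul2n spread_double IH expnS. Qed.

Lemma spreadD_exp2 u i : (i < 2 ^ u)%N -> spread (i + 2 ^ u) = (spread i + 4 ^ u)%N.
Proof.
elim: u i => [|u IH] i; first by rewrite expn0; case: i.
rewrite expnS => iu; rewrite spreadE (spreadE i).
have -> : ((i + 2 * 2 ^ u)./2 = i./2 + 2 ^ u)%N by lia.
by rewrite IH ?expnS; lia.
Qed.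

Lemma interleaveDl u i j : (i < 2 ^ u)%N -> interleave (i + 2 ^ u) j = (interleave i j + 4 ^ u)%N.
Proof. by move=> iu; rewrite /interleave spreadD_exp2 //; lia. Qed.

Lemma interleaveDr u i j : (j < 2 ^ u)%N -> interleave i (j + 2 ^ u) = (interleave i j + 2 * 4 ^ u)%N.
Proof. by move=> iu; rewrite /interleave spreadD_exp2 //; lia. Qed.

Lemma weight_exp4 u : weight (4 ^ u) = (2 * 2 ^ u)%N.
Proof.
by have := weight_interleave (2 ^ u) 0; rewrite /interleave spread_exp2 !muln0 !addn0.
Qed.

Lemma weight_2exp4 u : weight (2 * 4 ^ u) = (3 * 2 ^ u)%N.
Proof.
by have := weight_interleave 0 (2 ^ u); rewrite /interleave spread_exp2 !muln0 !add0n.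
Qed.

Lemma interleave_lt u i j : (i < 2 ^ u)%N -> (j < 2 ^ u)%N -> (interleave i j < 4 ^ u)%N.
Proof.
elim: u i j => [|u IH] i j; first by rewrite !expn0; case: i j => [|i] [|j].
rewrite interleaveE !expnS => iu ju; have := IH i./2 j./2; lia.
Qed.

Lemma odd_bits_lt u n : (n < 4 ^ u)%N -> (even_bits n./2 < 2 ^ u)%N.
Proof.
elim: u n => [|u IH] n; first by rewrite expn0; case: n.
rewrite !expnS => nu; rewrite even_bitsE.
have -> : (n./2 %/ 4 = (n %/ 4)./2)%N by lia.
have := IH (n %/ 4)%N; lia.
Qed.
End Digits.

(** * The leading term of T_7 *)

Definition W5_pow n : fps 'F_2 := D ^+ (6 * n + 5).

(** Lowering i by one lowers the weight by 2. So for w = 2i + 3j these are the combinations of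
    powers of weight strictly below that of (i - 1, j). *)
Definition low w := Dspan (fun e : nat => (e %% 6 == 5)%N && (weight (e %/ 6) + 2 < w)%N).

Lemma low_sub w w' f : (w <= w')%N -> low w f -> low w' f.
Proof. by move=> ww; apply: Dspan_sub => e /andP [-> h]; rewrite (leq_trans h ww). Qed.

Lemma lowD w f g : low w f -> low w g -> low w (f + g).
Proof. exact: DspanD. Qed.

Lemma low_pow w n : (weight n + 2 < w)%N -> low w (W5_pow n).
Proof.
move=> nw; apply: Dspan_pow; rewrite (_ : ((6 * n + 5) %/ 6 = n)%N) ?nw; lia.
Qed.

Lemma low_mul a w w' f : (w + weight a <= w')%N -> low w f -> low w' (D ^+ (6 * a) * f).
Proof.
move=> ww'; apply: Dspan_mulX => e /andP [e6 ew].
have -> : ((6 * a + e) %/ 6 = a + e %/ 6)%N by lia.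
by have := weightD a (e %/ 6); move: (weight _) (weight _) (weight _) ew ww' => x y z; lia.
Qed.

Lemma mul_W5_pow a n : D ^+ (6 * a) * W5_pow n = W5_pow (a + n).
Proof. by rewrite /W5_pow -exprD mulnDr addnA. Qed.

Definition lead7 i j : fps 'F_2 := if i is i'.+1 then W5_pow (interleave i' j) else 0.

Definition trace7_bound i j := low (2 * i + 3 * j) (hecke 7 (W5_pow (interleave i j)) + lead7 i j).

Lemma trace7_bound_weak i j : trace7_bound i j ->
  low (2 * i + 3 * j).+1 (hecke 7 (W5_pow (interleave i j))).
Proof.
move=> H; rewrite -[X in low _ X]addr0 -(addff (lead7 i j)) addrA; apply: lowD.
  exact: low_sub H.
case: i {H} => [|i]; first exact: Dspan0.
by apply: low_pow; rewrite weight_interleave; lia.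
Qed.

Lemma hecke7_W5_rec s m : let q := (2 ^ s)%N in
  hecke 7 (W5_pow (m + 8 * q)) = D ^+ (6 * (8 * q)) * hecke 7 (W5_pow m)
   + (D ^+ (6 * q) * hecke 7 (W5_pow (m + q)) + D ^+ (6 * (2 * q)) * hecke 7 (W5_pow (m + 2 * q))).
Proof.
move=> q; have := hecke7_rec48 s (6 * m + 5); rewrite /W5_pow -/q.
have -> : (6 * (m + 8 * q) + 5 = 6 * m + 5 + 48 * q)%N by lia.
have -> : (6 * (m + q) + 5 = 6 * m + 5 + 6 * q)%N by lia.
have -> : (6 * (m + 2 * q) + 5 = 6 * m + 5 + 12 * q)%N by lia.
have -> : (6 * (8 * q) = 48 * q)%N by lia.
by have -> : (6 * (2 * q) = 12 * q)%N by lia.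
Qed.

(** [l] lists the terms other than the leading one. The largest exponent needed is 6 * 7 + 5 =
    47. *)
Lemma trace7_bound_table i j l : (interleave i j < 8)%N ->
  perm_eq (nth [::] (table7 48) (6 * interleave i j + 5)) [seq (6 * e + 5)%N
    | e <- (if i is i'.+1 then [:: interleave i' j] else [::]) ++ l] ->
  all (fun e => weight e + 2 < 2 * i + 3 * j)%N l -> trace7_bound i j.
Proof.
move=> n8 pl wl; rewrite /trace7_bound {1}/W5_pow (@table7P 48); last by lia.
rewrite (perm_big _ pl) big_map big_cat /=.
have -> : \sum_(e <- (if i is i'.+1 then [:: interleave i' j] else [::])) D ^+ (6 * e + 5) = lead7 i j.
  by case: (i) => [|i']; rewrite ?big_nil ?big_seq1.
rewrite addrAC addff add0r.
elim: l wl {pl} => [|e l IHl] /=; first by rewrite big_nil => _; exact: Dspan0.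
by move=> /andP [we wl]; rewrite big_cons; apply: lowD; [exact: low_pow | exact: IHl].
Qed.

Lemma trace7_bound_base i j : (i < 4)%N -> (j < 2)%N -> trace7_bound i j.
Proof.
case: i j => [|[|[|[|//]]]] [|[|//]] _ _.
- by apply: (@trace7_bound_table _ _ [::]); vm_compute.
- by apply: (@trace7_bound_table _ _ [::]); vm_compute.
- by apply: (@trace7_bound_table _ _ [::]); vm_compute.
- by apply: (@trace7_bound_table _ _ [::]); vm_compute.
- by apply: (@trace7_bound_table _ _ [::]); vm_compute.
- by apply: (@trace7_bound_table _ _ [::]); vm_compute.
- by apply: (@trace7_bound_table _ _ [:: 0]%N); vm_compute.
by apply: (@trace7_bound_table _ _ [:: 2]%N); vm_compute.
Qed.

Section Induction.
Variable N : nat.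
Hypothesis IH : forall i j, (interleave i j < N)%N -> trace7_bound i j.

Let weak n : (n < N)%N -> low (weight n).+1 (hecke 7 (W5_pow n)).
Proof.
move=> nN; have := @trace7_bound_weak (even_bits n) (even_bits n./2).
by rewrite interleave_bits; apply; apply: IH; rewrite interleave_bits.
Qed.

(* n = m + 8q with 8q = 2 * 4^u the top binary digit of n. *)
Lemma trace7_bound_top_odd i j u : (0 < u)%N -> (i < 2 ^ u.+1)%N -> (j < 2 ^ u)%N ->
  interleave i (j + 2 ^ u) = N -> trace7_bound i (j + 2 ^ u).
Proof.
case: u => // u _ iu ju eN; rewrite /trace7_bound.
set q := (4 ^ u)%N; set m := interleave i j.
have q2 : q = (2 ^ (2 * u))%N by rewrite expnM.
have em : interleave i (j + 2 ^ u.+1) = (m + 8 * q)%N by rewrite interleaveDr // expnS; lia.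
have q0 : (0 < q)%N by rewrite expn_gt0.
have p0 : (0 < 2 ^ u)%N by rewrite expn_gt0.
have wm : weight m = (2 * i + 3 * j)%N := weight_interleave i j.
have wq : weight q = (2 * 2 ^ u)%N := weight_exp4 u.
have w2q : weight (2 * q) = (3 * 2 ^ u)%N := weight_2exp4 u.
have w8q : weight (8 * q) = (6 * 2 ^ u)%N.
  by have := weight_2exp4 u.+1; rewrite !expnS (_ : (2 * (4 * 4 ^ u) = 8 * q)%N); lia.
have mN : (m + 8 * q)%N = N by rewrite -em.
rewrite em q2 hecke7_W5_rec -q2.
have -> : lead7 i (j + 2 ^ u.+1) = D ^+ (6 * (8 * q)) * lead7 i j.
  case: i @m iu eN em wm mN => [|i] m iu eN em wm mN; first by rewrite mulr0.
  by rewrite /lead7 mul_W5_pow interleaveDr //; congr W5_pow; rewrite expnS; lia.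
rewrite addrAC -mulrDr; apply: lowD; [|apply: lowD].
- apply: low_mul (IH _); last by rewrite -/m; lia.
  by rewrite w8q expnS; lia.
- apply: low_mul (weak _); last by lia.
  by have := weightD m q; rewrite wm wq expnS; lia.
(* For the term m + 2q the bound [weak] misses by one. If adding 2q = 2 * 4^u to m carries, the
   carry lowers the weight. If not, the full induction hypothesis applies, and its leading term,
   multiplied by D^(12q), has a carry that makes it low. *)
case: (leqP (2 ^ u) j) => uj.
  apply: low_mul (weak _); last by lia.
  have -> : (m + 2 * q = interleave i (j - 2 ^ u) + 4 ^ u.+1)%N.
    by rewrite /m -{1}(subnK uj) interleaveDr ?expnS; move: ju; rewrite ?expnS; lia.
  have := weightD (interleave i (j - 2 ^ u)) (4 ^ u.+1).
  by rewrite weight_interleave weight_exp4 w2q expnS; lia.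
have e2 : (m + 2 * q = interleave i (j + 2 ^ u))%N by rewrite interleaveDr.
rewrite -[X in low _ X]addr0 -(addff (D ^+ (6 * (2 * q)) * lead7 i (j + 2 ^ u))) addrA -mulrDr.
apply: lowD.
  rewrite e2; apply: low_mul (IH _); last by rewrite -e2; lia.
  by rewrite w2q expnS; lia.
rewrite /lead7; case: i @m iu eN em wm mN e2 => [|i] m iu eN em wm mN e2.
  by rewrite mulr0; exact: Dspan0.
rewrite mul_W5_pow; apply: low_pow; rewrite interleaveDr //.
have := weightD (interleave i j) (4 ^ u.+1); rewrite weight_interleave weight_exp4.
by rewrite (_ : (2 * q + (interleave i j + 2 * 4 ^ u) = interleave i j + 4 ^ u.+1)%N) expnS; lia.
Qed.

(* n = m + 8q with 8q = 4^u the top binary digit of n. *)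
Lemma trace7_bound_top_even i j u : (1 < u)%N -> (i < 2 ^ u)%N -> (j < 2 ^ u)%N ->
  interleave (i + 2 ^ u) j = N -> trace7_bound (i + 2 ^ u) j.
Proof.
case: u => [|[|u]] // _ iu ju eN; rewrite /trace7_bound.
set q := (2 * 4 ^ u)%N; set m := interleave i j.
have q2 : q = (2 ^ (2 * u).+1)%N by rewrite expnS expnM.
have em : interleave (i + 2 ^ u.+2) j = (m + 8 * q)%N by rewrite interleaveDl // !expnS; lia.
have q0 : (0 < q)%N by rewrite muln_gt0 expn_gt0.
have p0 : (0 < 2 ^ u)%N by rewrite expn_gt0.
have wm : weight m = (2 * i + 3 * j)%N := weight_interleave i j.
have wq : weight q = (3 * 2 ^ u)%N := weight_2exp4 u.
have e2q : (2 * q = 4 ^ u.+1)%N by rewrite expnS /q; lia.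
have w2q : weight (2 * q) = (4 * 2 ^ u)%N by rewrite e2q weight_exp4 expnS; lia.
have w8q : weight (8 * q) = (8 * 2 ^ u)%N.
  by have := weight_exp4 u.+2; rewrite !expnS (_ : (4 * (4 * 4 ^ u) = 8 * q)%N); lia.
have mN : (m + 8 * q)%N = N by rewrite -em.
rewrite em q2 hecke7_W5_rec -q2.
have T1 : low (2 * (i + 2 ^ u.+2) + 3 * j) (D ^+ (6 * (8 * q)) * (hecke 7 (W5_pow m) + lead7 i j)).
  apply: low_mul (IH _); last by rewrite -/m; lia.
  by rewrite w8q !expnS; lia.
have T2 : low (2 * (i + 2 ^ u.+2) + 3 * j) (D ^+ (6 * q) * hecke 7 (W5_pow (m + q))).
  apply: low_mul (weak _); last by lia.
  by have := weightD m q; rewrite wm wq !expnS; lia.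
have leadS : (0 < i)%N -> lead7 (i + 2 ^ u.+2) j = D ^+ (6 * (8 * q)) * lead7 i j.
  clear - iu; case: i iu => // i iu _; rewrite addSn /lead7 mul_W5_pow interleaveDl; last by lia.
  by congr W5_pow; rewrite /q !expnS; lia.
(* Again [weak] misses by one at m + 2q, now with 2q = 4^(u+1), and the cases are according to a
   carry among the digits of i. *)
case: (leqP (2 ^ u.+1) i) => ui.
  rewrite leadS; last by move: ui; rewrite expnS; lia.
  rewrite addrAC -mulrDr; apply: lowD => //; apply: lowD => //.
  apply: low_mul (weak _); last by lia.
  have -> : (m + 2 * q = interleave (i - 2 ^ u.+1) j + 2 * 4 ^ u.+1)%N.
    by rewrite /m -{1}(subnK ui) interleaveDl ?e2q; move: iu ui; rewrite ?expnS; lia.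
  have := weightD (interleave (i - 2 ^ u.+1) j) (2 * 4 ^ u.+1).
  by rewrite weight_interleave weight_2exp4 w2q; move: ui; rewrite !expnS; lia.
have e2 : (m + 2 * q = interleave (i + 2 ^ u.+1) j)%N by rewrite interleaveDl ?e2q.
have T3 : low (2 * (i + 2 ^ u.+2) + 3 * j)
    (D ^+ (6 * (2 * q)) * (hecke 7 (W5_pow (m + 2 * q)) + lead7 (i + 2 ^ u.+1) j)).
  rewrite e2; apply: low_mul (IH _); last by rewrite -e2; lia.
  by rewrite w2q !expnS; lia.
(* For i = 0 the first term of the recursion has no leading term. The third one supplies it, because
   2^(u+2) - 1 = (2^(u+1) - 1) + 2^(u+1). *)
case: (posnP i) => [i0|ipos].
  have L0 : lead7 i j = 0 by rewrite i0.
  have -> : lead7 (i + 2 ^ u.+2) j = D ^+ (6 * (2 * q)) * lead7 (i + 2 ^ u.+1) j.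
    rewrite i0 !add0n /lead7.
    case E1 : (2 ^ u.+1)%N => [|a]; first by move: E1; rewrite expnS; lia.
    case E2 : (2 ^ u.+2)%N => [|b]; first by move: E2; rewrite expnS; lia.
    rewrite mul_W5_pow e2q; congr W5_pow.
    by rewrite addnC -interleaveDl; [congr interleave; move: E2; rewrite expnS E1|]; lia.
  rewrite L0 addr0 in T1; rewrite -!addrA -mulrDr.
  by apply: lowD => //; apply: lowD.
rewrite leadS // addrAC -mulrDr; apply: lowD => //; apply: lowD => //.
rewrite -[X in low _ X]addr0 -(addff (D ^+ (6 * (2 * q)) * lead7 (i + 2 ^ u.+1) j)) addrA -mulrDr.
apply: lowD => //.
clear - ipos ui wm e2q; case: i ipos ui @m wm => // i _ ui m wm.
rewrite addSn /lead7 mul_W5_pow interleaveDl; last by lia.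
apply: low_pow; have := weightD (interleave i j) (2 * 4 ^ u.+1).
rewrite weight_interleave weight_2exp4 e2q.
have p0 : (0 < 2 ^ u)%N by rewrite expn_gt0.
rewrite (_ : (4 ^ u.+1 + (interleave i j + 4 ^ u.+1) = interleave i j + 2 * 4 ^ u.+1)%N); last by lia.
by rewrite !expnS; lia.
Qed.
End Induction.

Theorem trace7_leading i j : trace7_bound i j.
Proof.
have [n] := ubnP (interleave i j); elim: n i j => // n IHn i j ijn.
have IH i' j' : (interleave i' j' < interleave i j)%N -> trace7_bound i' j'.
  by move=> h; apply: IHn; rewrite (leq_trans h).
case: (posnP (maxn i j)) => [|pos].
  move/eqP; rewrite -leqn0 geq_max !leqn0 => /andP [/eqP -> /eqP ->].
  exact: trace7_bound_base.
have /= := trunc_log_bounds (isT : 1 < 2)%N pos; set u := trunc_log _ _; move: u => u.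
rewrite leq_max gtn_max => /andP [lo /andP [iu ju]].
(* The top binary digit of [interleave i j] is 2 * 4^u if 2^u <= j, and 4^u otherwise. *)
case: (leqP (2 ^ u) j) => uj.
  case: (posnP u) => [u0|upos].
    by apply: trace7_bound_base; move: iu ju; rewrite u0 expn1; lia.
  have [j' ej] : exists j', j = (j' + 2 ^ u)%N by exists (j - 2 ^ u)%N; rewrite subnK.
  rewrite ej in IH ju *; apply: (trace7_bound_top_odd IH upos iu _ (erefl _)).
  by move: ju; rewrite expnS; lia.
case: (ltnP 1 u) => u1; last first.
  apply: trace7_bound_base.
    by apply: leq_trans iu _; rewrite -[4%N]/(2 ^ 2)%N leq_exp2l.
  by apply: leq_trans uj _; rewrite -[X in (_ <= X)%N]/(2 ^ 1)%N leq_exp2l.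
have ui : (2 ^ u <= i)%N by case/orP: lo => // h; move: uj; rewrite ltnNge h.
have [i' ei] : exists i', i = (i' + 2 ^ u)%N by exists (i - 2 ^ u)%N; rewrite subnK.
rewrite ei in IH iu *; apply: (trace7_bound_top_even IH u1 _ uj (erefl _)).
by move: iu; rewrite expnS; lia.
Qed.

(** * Gaussian integers and the nonvanishing of T_13^(2^r - 1) *)

Section HeckePowers.
Variables (p n0 : nat).
Hypotheses (p_gt1 : (1 < p)%N) (pn0 : ~~ (p %| n0)%N).

(* The coefficients at n0 p^m, extended to an even function of m + 1 in Z; on
   these sequences hecke p acts by u(a) |-> u(a + 1) + u(a - 1). *)
Definition ray_coef (f : fps 'F_2) (a : int) : 'F_2 :=
  if `|a|%N is m.+1 then fcoef f (n0 * p ^ m)%N else 0.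

Lemma ray_coefS f m : ray_coef f (Posz m.+1) = fcoef f (n0 * p ^ m)%N.
Proof. by []. Qed.

Lemma ray_coef_hecke f a : ray_coef (hecke p f) a = ray_coef f (a + 1) + ray_coef f (a - 1).
Proof.
have pos m : ray_coef (hecke p f) (Posz m.+1) = ray_coef f (Posz m.+2) + ray_coef f (Posz m).
  rewrite !ray_coefS heckeE fcoefD fcoef_user fcoef_vser.
  rewrite mulnCA -expnS; congr (_ + _); case: m => [|m]; first by rewrite expn0 muln1 (negbTE pn0).
  by rewrite ray_coefS expnS mulnCA dvdn_mulr // mulKn // ltnW.
have even g x : ray_coef g (- x) = ray_coef g x by rewrite /ray_coef abszN.
case: a => [[|m]|m].
- by rewrite /ray_coef /= addff2.
- by rewrite pos; congr (ray_coef _ _ + ray_coef _ _); lia.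
rewrite NegzE even pos addrC; congr (_ + _); rewrite -[RHS]even; congr ray_coef; lia.
Qed.

(** With S the shift of sequences, (S + S^-1)^(2^r) = S^(2^r) + S^(-2^r) modulo 2. *)
Lemma ray_coef_iter_exp2 r f a :
  ray_coef (iter (2 ^ r) (hecke p) f) a = ray_coef f (a + (2 ^ r)%:Z) + ray_coef f (a - (2 ^ r)%:Z).
Proof.
elim: r f a => [|r IH] f a; first by rewrite expn0 /= ray_coef_hecke.
rewrite expnS mul2n -addnn iterD !IH PoszD !addrA subrK opprD !addrA addrK.
by rewrite -!addrA [ray_coef f a + _]addrA addff2 add0r.
Qed.

(** As 2^(r+1) - 1 = (2^r - 1) + 2^r, induction turns the value at 1 into the value at 2^r, and 2^r
    further steps turn this into the values at 2^(r+1) and at 0, where [ray_coef] vanishes. *)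
Lemma fcoef_iter_hecke r f :
  fcoef (iter (2 ^ r).-1 (hecke p) f) n0 = fcoef f (n0 * p ^ (2 ^ r).-1)%N.
Proof.
have H g : ray_coef (iter (2 ^ r).-1 (hecke p) g) 1 = ray_coef g (2 ^ r)%:Z.
  elim: r g => [|r IH] g //.
  have -> : (2 ^ r.+1).-1 = ((2 ^ r).-1 + 2 ^ r)%N by rewrite expnS; have := expn_gt0 2 r; lia.
  rewrite iterD IH ray_coef_iter_exp2 subrr [X in _ + X](_ : _ = 0) // addr0.
  by congr ray_coef; rewrite expnS; lia.
have := H f; rewrite /ray_coef /= expn0 muln1.
by case: (2 ^ r)%N (expn_gt0 2 r).
Qed.
End HeckePowers.

(** * Gaussian integers of norm 5 * 13^M *)

Record gint := Gint { re : int; im : int }.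
Definition gint_pair x := (re x, im x).
Definition pair_gint p := Gint p.1 p.2.
Lemma gint_pairK : cancel gint_pair pair_gint. Proof. by case. Qed.
HB.instance Definition _ := Choice.copy gint (can_type gint_pairK).

Lemma gintP x y : re x = re y -> im x = im y -> x = y.
Proof. by case: x y => [a b] [c d] /= -> ->. Qed.

Definition gzero := Gint 0 0.
Definition gopp x := Gint (- re x) (- im x).
Definition gadd x y := Gint (re x + re y) (im x + im y).
Definition gone := Gint 1 0.
Definition gmul x y := Gint (re x * re y - im x * im y) (re x * im y + im x * re y).

Fact gaddA : associative gadd. Proof. by move=> x y z; apply: gintP => /=; rewrite addrA. Qed.
Fact gaddC : commutative gadd. Proof. by move=> x y; apply: gintP => /=; rewrite addrC. Qed.
Fact gadd0 : left_id gzero gadd. Proof. by move=> x; apply: gintP => /=; rewrite add0r. Qed.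
Fact gaddN : left_inverse gzero gopp gadd. Proof. by move=> x; apply: gintP => /=; rewrite addNr. Qed.
HB.instance Definition _ := GRing.isZmodule.Build gint gaddA gaddC gadd0 gaddN.

Fact gmulA : associative gmul. Proof. by move=> x y z; apply: gintP => /=; ring. Qed.
Fact gmulC : commutative gmul. Proof. by move=> x y; apply: gintP => /=; ring. Qed.
Fact gmul1 : left_id gone gmul. Proof. by move=> x; apply: gintP => /=; ring. Qed.
Fact gmulDl : left_distributive gmul gadd. Proof. by move=> x y z; apply: gintP => /=; ring. Qed.
Fact gone_neq0 : gone != gzero :> gint. Proof. by []. Qed.
HB.instance Definition _ := GRing.Zmodule_isComNzRing.Build gint gmulA gmulC gmul1 gmulDl gone_neq0.

Lemma reM (x y : gint) : re (x * y) = re x * re y - im x * im y. Proof. by []. Qed.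
Lemma imM (x y : gint) : im (x * y) = re x * im y + im x * re y. Proof. by []. Qed.

Definition gnorm (x : gint) : int := re x ^+ 2 + im x ^+ 2.
Lemma gnormM x y : gnorm (x * y) = gnorm x * gnorm y.
Proof. by rewrite /gnorm reM imM; ring. Qed.

(* A prime above 13, its conjugate, and a prime above 5. *)
Definition mu : gint := Gint 3 2.
Definition mu' : gint := Gint 3 (-2).
Definition rho : gint := Gint 1 2.

Definition alpha M e : gint := rho * mu ^+ e * mu' ^+ (M - e).

Lemma gnorm_alpha M e : (e <= M)%N -> gnorm (alpha M e) = 5 * 13 ^+ M.
Proof.
have pw x k : gnorm x = 13 -> gnorm (x ^+ k) = 13 ^+ k.
  by move=> x13; elim: k => // k IH; rewrite !exprS gnormM x13 IH.
by move=> eM; rewrite /alpha !gnormM !pw // -mulrA -exprD subnKC.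
Qed.

Lemma alphaS_mu M e : alpha M.+1 e.+1 = mu * alpha M e.
Proof. by rewrite /alpha subSS exprS; ring. Qed.

Lemma alphaS_mu' M e : (e <= M)%N -> alpha M.+1 e = mu' * alpha M e.
Proof. by move=> eM; rewrite /alpha subSn // exprS; ring. Qed.

(** Descent on M: (3a + 2b) (3a - 2b) = 13 a^2 - 4 (a^2 + b^2) is divisible by 13, hence one factor
    is, and a + bi is then divisible by [mu] or [mu']. The independent signs s and t account for
    conjugation and for the units 1 and -1; a odd excludes the other two units. *)
Lemma gauss_classification M (a b : int) : (a %% 2 = 1)%Z -> a ^+ 2 + b ^+ 2 = 5 * 13 ^+ M ->
  exists2 e, (e <= M)%N & exists s t : int, [/\ s ^+ 2 = 1, t ^+ 2 = 1,
    a = s * re (alpha M e) & b = t * im (alpha M e)].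
Proof.
pose sg (s : int) := s = 1 \/ s = -1.
suff H : (a %% 2 = 1)%Z -> a ^+ 2 + b ^+ 2 = 5 * 13 ^+ M ->
    exists2 e, (e <= M)%N & exists s t : int, [/\ sg s, sg t,
    a = s * re (alpha M e) & b = t * im (alpha M e)].
  move=> a2 ab; have [e eM [s [t [ss ts ? ?]]]] := H a2 ab.
  by exists e => //; exists s, t; split=> //; [case: ss => -> | case: ts => ->].
elim: M a b => [|M IH] a b a2 ab.
  exists 0%N => //.
  have -> : re (alpha 0 0) = 1 by []. have -> : im (alpha 0 0) = 2 by [].
  rewrite expr0 mulr1 in ab.
  have a3 : -2 <= a <= 2 by apply/andP; split; nia.
  have sa : sg a by rewrite /sg; lia.
  have b2 : b ^+ 2 = 4 by case: sa ab => ->; lia.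
  have : b = 2 \/ b = -2 by nia.
  by case=> ->; [exists a, 1 | exists a, (-1)]; split; rewrite ?mulr1 //; [left | right].
have [c [d [eN cd]]] : exists c d : int, c ^+ 2 + d ^+ 2 = 5 * 13 ^+ M /\
   ((a = 3 * c - 2 * d /\ b = 2 * c + 3 * d) \/ (a = 3 * c + 2 * d /\ b = 3 * d - 2 * c)).
  pose P := (3 * a + 2 * b) * (3 * a - 2 * b).
  have key : (13 %| absz P)%N.
    have -> : P = 13 * (a ^+ 2 - 4 * 5 * 13 ^+ M).
      transitivity (13 * a ^+ 2 - 4 * (a ^+ 2 + b ^+ 2)); first by rewrite /P; ring.
      by rewrite ab [13 ^+ M.+1]exprS; ring.
    by rewrite abszM dvdn_mulr.
  have canc (x : int) : 13 * x = 5 * 13 ^+ M.+1 -> x = 5 * 13 ^+ M.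
    by rewrite [13 ^+ M.+1]exprS mulrCA; apply: mulfI.
  rewrite /P abszM Euclid_dvdM // in key; case/orP: key => key.
    have [c ec] : exists c, 3 * a + 2 * b = 13 * c.
      by have /dvdzP [c ->] : (13 %| (3 * a + 2 * b))%Z := key; exists c; rewrite mulrC.
    have [t et] : exists t, a = c + 2 * t by exists ((a - c) %/ 2)%Z; lia.
    exists c, (c - t); split; last by left; lia.
    apply: canc; rewrite -ab et (_ : b = 5 * c - 3 * t); [ring | lia].
  have [c ec] : exists c, 3 * a - 2 * b = 13 * c.
    by have /dvdzP [c ->] : (13 %| (3 * a - 2 * b))%Z := key; exists c; rewrite mulrC.
  have [t et] : exists t, a = c + 2 * t by exists ((a - c) %/ 2)%Z; lia.
  exists c, (t - c); split; last by right; lia.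
  apply: canc; rewrite -ab et (_ : b = 3 * t - 5 * c); [ring | lia].
have c2 : (c %% 2 = 1)%Z by lia.
have [e eM [s [t [ss ts ec ed]]]] := IH c d c2 eN.
have sgN x : sg x -> sg (- x) by case=> ->; [right | left].
set A := alpha M e in ec ed.
(* For t = -s the number c + di is the conjugate of A up to sign, and multiplying it by [mu] gives
   the conjugate of [mu'] A. *)
have st : t = s \/ t = - s by case: ss => ->; case: ts => ->; auto.
have e1 : exists2 e', (e' <= M.+1)%N & alpha M.+1 e' = mu * A by exists e.+1; rewrite ?alphaS_mu.
have e2 : exists2 e', (e' <= M.+1)%N & alpha M.+1 e' = mu' * A by exists e; rewrite ?alphaS_mu' // leqW.
have reA : re (mu * A) = 3 * re A - 2 * im A by [].
have imA : im (mu * A) = 3 * im A + 2 * re A by [].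
have reA' : re (mu' * A) = 3 * re A + 2 * im A by rewrite reM /=; ring.
have imA' : im (mu' * A) = 3 * im A - 2 * re A by rewrite imM /=; ring.
case: st cd ed => -> [[-> ->]|[-> ->]] ->; rewrite ec.
- by case: e1 => e' ? E; exists e' => //; exists s, s; split=> //; rewrite E ?reA ?imA; ring.
- by case: e2 => e' ? E; exists e' => //; exists s, s; split=> //; rewrite E ?reA' ?imA'; ring.
- case: e2 => e' ? E; exists e' => //; exists s, (- s).
  by split=> //; rewrite ?E ?reA' ?imA'; [exact: sgN | ring | ring].
case: e1 => e' ? E; exists e' => //; exists s, (- s).
by split=> //; rewrite ?E ?reA ?imA; [exact: sgN | ring | ring].
Qed.

(* 2-adic valuations of a combination with odd coefficients. *)
Lemma dvdz_exp2_step k (P R S x y z : int) :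
  (P %% 2 = 1)%Z -> (R %% 2 = 1)%Z -> (S %% 2 = 1)%Z -> P * x = R * y + z * S ->
  (2 ^+ k %| y)%Z -> (2 ^+ k %| z)%Z ->
  (2 ^+ k %| x)%Z /\ (2 ^+ k.+1 %| x)%Z = ((2 ^+ k.+1 %| y)%Z == (2 ^+ k.+1 %| z)%Z).
Proof.
move=> P2 R2 S2 E /dvdzP [y' ey] /dvdzP [z' ez].
have cop u : (u %% 2 = 1)%Z -> coprimez 2 u by rewrite coprimezE coprime2n; lia.
have kx : (2 ^+ k %| x)%Z.
  rewrite -(@Gauss_dvdzr _ P); last by apply/coprimezXl/cop.
  by rewrite E ey ez; apply/dvdzP; exists (R * y' + z' * S); ring.
split=> //; case/dvdzP: kx => x' ex.
have k0 : 2 ^+ k != 0 :> int by rewrite expf_neq0.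
have E' : P * x' = R * y' + z' * S.
  by apply: (mulfI k0); transitivity (P * x); [rewrite ex | rewrite E ey ez]; ring.
have red w : (2 ^+ k.+1 %| w * 2 ^+ k)%Z = (2 %| w)%Z by rewrite exprS dvdz_mul2r.
rewrite ex ey ez !red.
have odd_mul u v : (u %% 2 = 1)%Z -> (2 %| u * v)%Z = (2 %| v)%Z.
  by move=> u2; rewrite Gauss_dvdzr // cop.
rewrite -(odd_mul P x') // -(odd_mul R y') // -(odd_mul S z') // E' (mulrC z').
by move: (R * y') (S * z') => u v; lia.
Qed.

(* nu = mu / mu' up to the rational factor 13. *)
Definition nu : gint := mu ^+ 2.

Lemma mu_mul_mu' : mu * mu' = Gint 13 0. Proof. by []. Qed.

Lemma re_im_scale (c : int) (x : gint) :
  re (Gint c 0 * x) = c * re x /\ im (Gint c 0 * x) = c * im x.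
Proof. by rewrite reM imM /=; split; ring. Qed.

Lemma gint13X d : Gint 13 0 ^+ d = Gint (13 ^+ d) 0.
Proof. by elim: d => // d IH; rewrite !exprS IH; apply: gintP; rewrite ?reM ?imM /=; ring. Qed.

Lemma alpha_shift M e d : (e + d <= M)%N ->
  Gint (13 ^+ d) 0 * alpha M (e + d) = alpha M e * nu ^+ d.
Proof.
move=> edM; rewrite -gint13X -mu_mul_mu' /alpha /nu -exprM mul2n -addnn !exprD exprMn.
have -> : (M - e = M - (e + d) + d)%N by lia.
by rewrite exprD; ring.
Qed.

Lemma alpha_parity M e : (re (alpha M e) %% 2 = 1)%Z /\ (im (alpha M e) %% 2 = 0)%Z.
Proof.
have P x y : (re x %% 2 = 1)%Z /\ (im x %% 2 = 0)%Z -> (re y %% 2 = 1)%Z /\ (im y %% 2 = 0)%Z ->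
   (re (x * y) %% 2 = 1)%Z /\ (im (x * y) %% 2 = 0)%Z.
  move=> [a b] [c d]; rewrite reM imM.
  have [a' ea] : exists k, re x = 2 * k + 1 by exists (re x %/ 2)%Z; lia.
  have [b' eb] : exists k, im x = 2 * k by exists (im x %/ 2)%Z; lia.
  have [c' ec] : exists k, re y = 2 * k + 1 by exists (re y %/ 2)%Z; lia.
  have [d' ed] : exists k, im y = 2 * k by exists (im y %/ 2)%Z; lia.
  rewrite ea eb ec ed; split.
    rewrite (_ : _ - _ = 2 * (2 * a' * c' + a' + c' - 2 * b' * d') + 1); last by ring.
    by move: (_ - _) => w; lia.
  rewrite (_ : _ + _ = 2 * ((2 * a' + 1) * d' + b' * (2 * c' + 1))); last by ring.
  by move: (_ + _) => w; lia.
have X x k : (re x %% 2 = 1)%Z /\ (im x %% 2 = 0)%Z ->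
    (re (x ^+ k) %% 2 = 1)%Z /\ (im (x ^+ k) %% 2 = 0)%Z.
  by move=> hx; elim: k => // k IH; rewrite exprS; apply: P.
by apply: (P (_ * _)); [apply: P => // |]; apply: X.
Qed.

Lemma nuX_parity d : (re (nu ^+ d) %% 2 = 1)%Z /\
  (im (nu ^+ d) %% 8 = if odd d then 4 else 0)%Z.
Proof.
elim: d => // d [IH1 IH2]; rewrite exprSr reM imM.
have -> : re nu = 5 by []. have -> : im nu = 12 by [].
by move: (re _) (im _) IH1 IH2 => a b a2 b8; rewrite /=; case: (odd d) b8 => /= b8; split; lia.
Qed.

(** For odd d the 2-adic valuation of the imaginary part is 2, by [nuX_parity]. Each doubling of d
    adds one, because im (z^2) = 2 re z im z with re z odd. *)
Lemma dvdz_im_nuX k d : (2 ^+ k.+2 %| im (nu ^+ d))%Z = (2 ^ k %| d)%N.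
Proof.
elim: k d => [|k IH] d.
  rewrite expn0 dvd1n; have [_] := nuX_parity d; rewrite -[2 ^+ 2]/(4 : int).
  by case: (odd d); move: (im _) => b; lia.
have [od|ev] := boolP (odd d).
  have -> : (2 ^ k.+1 %| d)%N = false.
    apply/negbTE/negP; rewrite expnS => /(dvdn_trans (dvdn_mulr _ (dvdnn 2))).
    by rewrite dvdn2 od.
  have [_] := nuX_parity d; rewrite od => b8; apply/negbTE/negP => h.
  have : (8 %| im (nu ^+ d))%Z.
    by apply: dvdz_trans h; rewrite (exprD 2 3 k) dvdz_mulr.
  by move: (im _) b8 => b; lia.
have [h ->] : exists h, d = (2 * h)%N by exists d./2; lia.
rewrite expnS dvdn_pmul2l // -IH mul2n -addnn exprD imM exprS.
rewrite (_ : _ + _ = 2 * (re (nu ^+ h) * im (nu ^+ h))); last by ring.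
rewrite dvdz_mul2l // Gauss_dvdzr // coprimezXl // coprimezE coprime2n.
by have [] := nuX_parity h; move: (re _) => a; lia.
Qed.

Section ExactDivisibility.
Variable r : nat.
Let M := (2 ^ r).-1.

Let ediv k (x : int) := (2 ^+ k %| x)%Z && ~~ (2 ^+ k.+1 %| x)%Z.

Let p13_odd d : (13 ^+ d %% 2 = 1 :> int)%Z.
Proof. by elim: d => // d IH; rewrite exprS; move: (13 ^+ d) IH => a; lia. Qed.

Let shift e d : (e + d <= M)%N -> 13 ^+ d * im (alpha M (e + d)) =
  re (alpha M e) * im (nu ^+ d) + im (alpha M e) * re (nu ^+ d).
Proof.
move=> edM; have [_ <-] := re_im_scale (13 ^+ d) (alpha M (e + d)).
by rewrite alpha_shift // imM.
Qed.

(** The binary digits of e are chosen one by one. If 2^(k+2) divides the imaginary part, adding 2^k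
    to e preserves this and reverses divisibility by 2^(k+3), since 2^(k+2) divides im (nu^(2^k))
    exactly. The last digit is chosen to exclude divisibility by 2^(r+2). *)
Lemma exact_alpha_exists : exists2 e, (e <= M)%N & ediv r.+1 (im (alpha M e)).
Proof.
rewrite /M; case: (posnP r) => [->|rpos]; first by exists 0%N.
have base : (2 ^+ 2 %| im (alpha M 0))%Z.
  have -> : alpha M 0 = rho * mu' ^+ M by rewrite /alpha expr0 mulr1 subn0.
  have [h ->] : exists h, M = (2 * h).+1%N.
    exists ((2 ^ r.-1).-1); rewrite /M -{1}(prednK rpos) expnS.
    by have := expn_gt0 2 r.-1; lia.
  rewrite exprS exprM.
  have : (re ((mu' ^+ 2) ^+ h) %% 4 = 1)%Z /\ (im ((mu' ^+ 2) ^+ h) %% 4 = 0)%Z.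
    elim: h => // h [IH1 IH2]; rewrite exprSr reM imM.
    have -> : re (mu' ^+ 2) = 5 by []. have -> : im (mu' ^+ 2) = -12 by [].
    by move: (re _) (im _) IH1 IH2 => a b; lia.
  rewrite mulrA imM; have -> : re (rho * mu') = 7 by []. have -> : im (rho * mu') = 4 by [].
  by rewrite -[2 ^+ 2]/(4 : int); move: (re _) (im _) => a b; lia.
have nuE k : (2 ^+ k.+2 %| im (nu ^+ (2 ^ k)))%Z && ~~ (2 ^+ k.+3 %| im (nu ^+ (2 ^ k)))%Z.
  by rewrite !dvdz_im_nuX dvdnn /= gtnNdvd ?expn_gt0 // ltn_exp2l.
have ascend k e : (e + 2 ^ k <= M)%N -> (2 ^+ k.+2 %| im (alpha M e))%Z ->
    (2 ^+ k.+2 %| im (alpha M (e + 2 ^ k)))%Z /\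
    (2 ^+ k.+3 %| im (alpha M (e + 2 ^ k)))%Z = ~~ (2 ^+ k.+3 %| im (alpha M e))%Z.
  move=> ek He; have /andP [n1 /negbTE n2] := nuE k.
  have := dvdz_exp2_step (p13_odd _) (alpha_parity M e).1 (nuX_parity _).1 (shift ek) n1 He.
  by rewrite n2 => -[-> ->]; case: (_ %| _)%Z.
have climb k : (k < r)%N -> exists2 e, (e < 2 ^ k)%N & (2 ^+ k.+2 %| im (alpha M e))%Z.
  elim: k => [|k IH] kr; first by exists 0%N.
  have [e ek He] := IH (ltnW kr).
  have [|He'] := boolP (2 ^+ k.+3 %| im (alpha M e))%Z; first by exists e; rewrite // expnS; lia.
  have bound : (e + 2 ^ k <= M)%N.
    have : (2 ^ k.+1 <= 2 ^ r)%N by rewrite leq_exp2l // ltnW.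
    by rewrite /M expnS; lia.
  have [_] := ascend k e bound He; rewrite He' => H.
  by exists (e + 2 ^ k)%N; rewrite // expnS; lia.
have [e er He] := climb r.-1 (ltac:(by rewrite prednK)).
have rS : r.+1 = r.-1.+2 by rewrite prednK.
have e2 : (2 ^ r = 2 * 2 ^ r.-1)%N by rewrite -expnS prednK.
have bound : (e + 2 ^ r.-1 <= M)%N by rewrite /M e2; lia.
have [|He'] := boolP (2 ^+ r.-1.+3 %| im (alpha M e))%Z; last first.
  by exists e; [rewrite -/M; lia | rewrite rS; apply/andP].
have [H1 H2] := ascend _ _ bound He => He'; exists (e + 2 ^ r.-1)%N => //.
by rewrite rS; apply/andP; split; last rewrite H2 negbK.
Qed.

(** Two imaginary parts of exact valuation r + 1, with odd coefficients, combine to a multiple of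
    2^(r+2). So 2^(r+2) divides im (nu^(e' - e)), and 2^r divides e' - e, which is less than 2^r. *)
Lemma exact_alpha_unique e e' : (e <= M)%N -> (e' <= M)%N ->
  ediv r.+1 (im (alpha M e)) -> ediv r.+1 (im (alpha M e')) -> e = e'.
Proof.
wlog : e e' / (e < e')%N => [H eM e'M He He'|].
  by case: (ltngtP e e') => // lt; [exact: H | apply/esym/H].
move=> lt eM e'M /andP [He /negbTE nHe] /andP [He' /negbTE nHe'].
have eq' : (e + (e' - e) = e')%N by lia.
have S := @shift e (e' - e); rewrite eq' in S.
have S' : re (alpha M e) * im (nu ^+ (e' - e)) =
    13 ^+ (e' - e) * im (alpha M e') + im (alpha M e) * (- re (nu ^+ (e' - e))).
  by rewrite (S e'M); ring.
have oN : ((- re (nu ^+ (e' - e))) %% 2 = 1)%Z.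
  by have [] := nuX_parity (e' - e); move: (re _) => a; lia.
have [_] := dvdz_exp2_step (alpha_parity M e).1 (p13_odd _) oN S' He' He.
rewrite nHe nHe' eqxx dvdz_im_nuX => /(dvdn_leq) h.
by move: h; rewrite subn_gt0 lt => /(_ isT); move: e'M; rewrite /M; lia.
Qed.

Lemma unique_representation : exists a0 b0 : nat, forall a b : nat,
  [&& odd a, odd b & (a ^ 2 + (2 ^ r.+1 * b) ^ 2 == 5 * 13 ^ M)%N] = (a == a0) && (b == b0).
Proof.
have [e eM He] := exact_alpha_exists.
have [/dvdzP [c ec] nHe] := andP He.
exists `|re (alpha M e)|%N, `|c|%N => a b.
have [oa|ea] := boolP (odd a); last first.
  apply/esym/negbTE/nandP; left; apply: contra ea => /eqP ->.
  by have [] := alpha_parity M e; move: (re _) => x; lia.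
rewrite andTb.
have k0 : 2 ^+ r.+1 != 0 :> int by rewrite expf_neq0.
have abs_im (w : int) : absz (w * 2 ^+ r.+1) = (2 ^ r.+1 * absz w)%N by rewrite abszM abszX mulnC.
have ediv_odd (w : int) : ediv r.+1 (w * 2 ^+ r.+1) = odd `|w|%N.
  by rewrite /ediv dvdz_mull // [2 ^+ r.+2]exprS dvdz_mul2r //; lia.
have p0 : (0 < 2 ^ r.+1)%N by rewrite expn_gt0.
apply/andP/andP => [[ob /eqP eab]|[/eqP -> /eqP ->]].
  have [||e' e'M [s [t [s2 t2 ea eb]]]] := @gauss_classification M a%:Z (2 ^+ r.+1 * b%:Z).
  - by lia.
  - by have := congr1 (fun n => n%:R : int) eab; rewrite natrD natrM !natrX natrM natrX !natz.
  have abs1 (u : int) : u ^+ 2 = 1 -> `|u|%N = 1%N.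
    by move=> u2; apply/eqP; rewrite -(@eqn_exp2r _ _ 2) // exp1n -abszX u2.
  have eb' : `|im (alpha M e')|%N = (2 ^ r.+1 * b)%N.
    by have := congr1 absz eb; rewrite !abszM abszX (abs1 t) // mul1n => <-.
  have ee : e = e'.
    apply: exact_alpha_unique => //.
    have [w ew] : exists w, im (alpha M e') = w * 2 ^+ r.+1.
      exists (t * b%:Z); transitivity (t ^+ 2 * im (alpha M e')); first by rewrite t2 mul1r.
      by rewrite expr2 -mulrA -eb; ring.
    rewrite ew ediv_odd; move: eb'; rewrite ew abs_im => /eqP.
    by rewrite eqn_pmul2l // => /eqP ->.
  split; apply/eqP.
    by have := congr1 absz ea; rewrite abszM (abs1 s) // mul1n ee.
  by apply/eqP; rewrite -(eqn_pmul2l p0) -eb' -ee ec abs_im.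
split; first by rewrite -ediv_odd -ec.
rewrite -abs_im -ec; apply/eqP.
have := congr1 absz (gnorm_alpha eM); rewrite abszM abszX => <-; rewrite /gnorm -!abszX.
have := Num.Theory.sqr_ge0 (re (alpha M e)); have := Num.Theory.sqr_ge0 (im (alpha M e)).
by move: (_ ^+ 2) (_ ^+ 2) => x y; lia.
Qed.
End ExactDivisibility.

(** D^(4^(r+1)) is D(x^(4^(r+1))), so the coefficient counts the solutions of a^2 + 4^(r+1) b^2 = n
    with a, b prime to 6. Only oddness matters here: n = 2 mod 3 makes a and b prime to 3. *)
Lemma fcoef_W5_pow_theta r :
  fcoef (D ^+ (1 + 4 ^ r.+1)) (5 * 13 ^ (2 ^ r).-1)%N = 1.
Proof.
have [a0 [b0 uniq_ab]] := unique_representation r.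
set n := (5 * 13 ^ _)%N in uniq_ab *.
rewrite exprD expr1 (_ : (4 ^ r.+1 = 2 ^ (2 * r.+1))%N); last by rewrite expnM.
rewrite exprf_vser -[X in X * _]vser_id Dser_theta fcoef_theta2 ?expn_gt0 //.
have cond (a b : nat) : [&& coprime a 6, coprime b 6 & (1 * a ^ 2 + 2 ^ (2 * r.+1) * b ^ 2 == n)%N] =
    (a == a0) && (b == b0).
  have c6 x : coprime x 6 = odd x && ~~ (3 %| x)%N.
    by rewrite (coprimeMr x 2 3) coprime_sym coprime2n coprime_sym prime_coprime.
  have e1 : (1 * a ^ 2 + 2 ^ (2 * r.+1) * b ^ 2 = a ^ 2 + (2 ^ r.+1 * b) ^ 2)%N.
    by rewrite mul1n mulnC (mulnC 2) expnM -expnMn mulnC.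
  rewrite e1 -uniq_ab !c6; have [/eqP en|_] := boolP (_ == n)%N; last by rewrite !andbF.
  have sq3 x : (x ^ 2 %% 3 = ~~ (3 %| x))%N.
    by rewrite /dvdn -modnXm; case: (x %% 3)%N (ltn_pmod x (isT : 0 < 3)%N) => [|[|[|]]].
  have n3 : (n %% 3 = 2)%N by rewrite /n -modnMmr -modnXm exp1n.
  have k3 : ~~ (3 %| 2 ^ r.+1)%N by rewrite Euclid_dvdX.
  have := n3; rewrite -en -modnDm !sq3 Euclid_dvdM // (negbTE k3) /=.
  by case: (3 %| a)%N (3 %| b)%N => [] [] //= _; rewrite !andbT.
have eq0 : (a0 ^ 2 + (2 ^ r.+1 * b0) ^ 2 = n)%N.
  by have := uniq_ab a0 b0; rewrite !eqxx => /and3P [_ _ /eqP].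
have p0 : (0 < 2 ^ r.+1)%N by rewrite expn_gt0.
have sq x : (x <= x ^ 2)%N by rewrite -mulnn; case: x => // x; rewrite leq_pmulr.
have a0n : (a0 < n.+1)%N by rewrite ltnS -eq0 (leq_trans (sq a0)) // leq_addr.
have b0n : (b0 < n.+1)%N.
  rewrite ltnS -eq0 (leq_trans _ (leq_addl _ _)) // (leq_trans _ (sq _)) //.
  by rewrite leq_pmull.
under eq_bigr => a _ do under eq_bigr => b _ do rewrite cond.
rewrite (bigD1 (Ordinal a0n)) //= [X in (_ + X)%N]big1 ?addn0; last first.
  by move=> i ia; rewrite big1 // => j _; rewrite -val_eqE /= in ia; rewrite (negbTE ia).
rewrite (bigD1 (Ordinal b0n)) //= !eqxx big1 // => i ib.
by rewrite -val_eqE /= in ib; rewrite (negbTE ib).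
Qed.

Lemma iter_hecke13_theta r :
  fcoef (iter (2 ^ r).-1 (hecke 13) (D ^+ (1 + 4 ^ r.+1))) 5 = 1.
Proof. by rewrite fcoef_iter_hecke // fcoef_W5_pow_theta. Qed.

(** * The socle of W5 *)

Lemma hecke7_rec_exp2 s k : let q := (2 ^ s)%N in
  hecke 7 (D ^+ (k + 8 * q)) = D ^+ (8 * q) * hecke 7 (D ^+ k)
   + (D ^+ q * hecke 7 (D ^+ (k + q)) + D ^+ (4 * q) * hecke 7 (D ^+ (k + 4 * q))).
Proof.
move=> q.
have e : D ^+ (8 * q) + vser 7 D ^+ (8 * q) + (D ^+ q * vser 7 D ^+ q
   + D ^+ (4 * q) * vser 7 D ^+ (4 * q)) = 0.
  have := modular_eq_7; rewrite /= addrA /q.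
  move: {q} s 8%N 4%N D (vser 7 D) => t a b d E.
  by rewrite !exprM -!exprMn -!exprfD2 => ->; rewrite expr0n expn_eq0.
clearbody q; move: {e} (8 * q)%N (4 * q)%N e => n b e.
rewrite (@hecke_monic_rec 7 D n [:: (q, q); (b, b)]) ?big_cons ?big_nil ?addr0 //=.
Qed.

(** For k = 1 and q a power of 2 the recursion leads from D^(1 + 8q) to D, D^(1 + q) and D^(1 + 4q),
    which D itself and exponents of the same shape exhaust. *)
Lemma hecke7_theta j : hecke 7 (D ^+ (1 + 2 ^ j)) = 0.
Proof.
have [n] := ubnP j; elim: n j => // n IH [|[|[|j]]] jn; try by rewrite hecke7_D_small.
have -> : (1 + 2 ^ j.+3 = 1 + 8 * 2 ^ j)%N by rewrite !expnS; lia.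
rewrite hecke7_rec_exp2 expr1 hecke_D1 // mulr0 add0r.
have -> : (1 + 4 * 2 ^ j = 1 + 2 ^ j.+2)%N by rewrite !expnS; lia.
by rewrite !IH ?mulr0 ?addr0 //; lia.
Qed.

Lemma sum_uniq_neq0 (l : seq nat) : uniq l -> l != [::] -> \sum_(e <- l) D ^+ e != 0.
Proof.
case: l => // a l; set s := a :: l => us _.
have ex : exists n, n \in s by exists a; rewrite mem_head.
case: (ex_minnP ex) => m ms min_m; apply/eqP => /(congr1 (fun f => fcoef f m)).
rewrite fcoef0 fcoef_sum (bigD1_seq m) //= big1_seq ?addr0.
  by have [_] := leadX m lead_D; rewrite mul1n => -> /eqP; rewrite oner_eq0.
move=> e /andP [em es]; have [z _] := leadX e lead_D; apply: z.
by rewrite mul1n ltn_neqAle eq_sym em min_m.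
Qed.

Lemma Dspan_indep k : ~ Dspan (fun e => e != k) (D ^+ k).
Proof.
case=> l lk; rewrite -sum_parity_norm => /(congr1 (+%R (D ^+ k))).
rewrite addff [RHS](_ : _ = \sum_(e <- k :: parity_norm l) D ^+ e); last by rewrite big_cons.
move/esym/eqP; apply/negP/sum_uniq_neq0 => //=.
rewrite filter_uniq ?undup_uniq // andbT mem_filter mem_undup negb_and; apply/orP; right.
by apply/negP => /(allP lk); rewrite eqxx.
Qed.

Lemma Dspan_sum P (I : Type) (r : seq I) (Q : pred I) (g : I -> fps 'F_2) :
  (forall i, Q i -> Dspan P (g i)) -> Dspan P (\sum_(i <- r | Q i) g i).
Proof. by move=> H; elim/big_ind: _ => //; [exact: Dspan0 | exact: DspanD]. Qed.

Lemma scaleF2 (c : 'F_2) (f : fps 'F_2) : c *: f = if c == 0 then 0 else f.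
Proof. by case: (F2_cases c) => ->; rewrite ?eqxx ?scale0r // scale1r. Qed.

Lemma heckeZ p c f : hecke p (c *: f) = c *: hecke p f.
Proof. by rewrite !scaleF2; case: ifP => // _; rewrite hecke0. Qed.

(** * The filtration of W5 by degree in D *)

Definition W5b B f := exists c : nat -> 'F_2, f = \sum_(m < B) c m *: W5_pow m.

Lemma W5bD B f g : W5b B f -> W5b B g -> W5b B (f + g).
Proof.
move=> [c ->] [d ->]; exists (fun m => c m + d m).
by rewrite -big_split /=; apply: eq_bigr => m _; rewrite scalerDl.
Qed.

Lemma W5b0 B : W5b B 0.
Proof. by exists (fun _ => 0); rewrite big1 // => m _; rewrite scale0r. Qed.

Lemma W5b_sum B (I : Type) (r : seq I) (Q : pred I) (g : I -> fps 'F_2) :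
  (forall i, Q i -> W5b B (g i)) -> W5b B (\sum_(i <- r | Q i) g i).
Proof. by move=> H; elim/big_ind: _ => //; [exact: W5b0 | exact: W5bD]. Qed.

Lemma W5bZ B c f : W5b B f -> W5b B (c *: f).
Proof. by rewrite scaleF2; case: ifP => // _ _; exact: W5b0. Qed.

Lemma W5b_pow B m : (m < B)%N -> W5b B (W5_pow m).
Proof.
move=> mB; exists (fun n => (n == m)%:R); rewrite (bigD1 (Ordinal mB)) //= eqxx scale1r.
by rewrite big1 ?addr0 // => i im; rewrite -val_eqE /= in im; rewrite (negbTE im) scale0r.
Qed.

Lemma W5b_Dspan B f : Dspan (fun e => (e < 6 * B)%N && (e %% 6 == 5)%N) f -> W5b B f.
Proof.
case=> l lB ->; rewrite big_seq; apply: W5b_sum => e /(allP lB) /andP [eB e5].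
rewrite (_ : D ^+ e = W5_pow (e %/ 6)); first by apply: W5b_pow; lia.
by congr (_ ^+ _); lia.
Qed.

Lemma W5b_le B B' f : (B <= B')%N -> W5b B f -> W5b B' f.
Proof.
move=> BB' [c ->]; apply: W5b_sum => m _; apply/W5bZ/W5b_pow.
exact: leq_trans (ltn_ord m) BB'.
Qed.

Lemma W5P f : W5 f <-> exists B, W5b B f.
Proof.
split=> [[N [c ->]]|[B [c ->]]].
  exists N; apply: W5b_sum => k k5; apply/W5bZ/W5b_Dspan/Dspan_pow.
  by move: (ltn_ord k) k5; move: (nat_of_ord k) => j; lia.
exists (6 * B)%N, (fun k => c (k %/ 6)%N).
pose g k := if (k %% 6 == 5)%N then c (k %/ 6)%N *: D ^+ k else 0.
transitivity (\sum_(k < 6 * B) g k); last by rewrite [RHS]big_mkcond.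
elim: B => [|B IH]; first by rewrite !big_ord0.
rewrite big_ord_recr /= {}IH mulnS addnC !addnS addn0 !big_ord_recr /= /g.
have -> : ((6 * B) %% 6 == 5)%N = false by lia.
have -> : ((6 * B).+1 %% 6 == 5)%N = false by lia.
have -> : ((6 * B).+2 %% 6 == 5)%N = false by lia.
have -> : ((6 * B).+3 %% 6 == 5)%N = false by lia.
have -> : ((6 * B).+4 %% 6 == 5)%N = false by lia.
have -> : ((6 * B).+4.+1 %% 6 == 5)%N by lia.
have -> : ((6 * B).+4.+1 %/ 6 = B)%N by lia.
by rewrite !addr0 /W5_pow !addnS addn0.
Qed.

Lemma W5b_hecke p B f : (p == 7%N) || (p == 13%N) -> W5b B f -> W5b B.-1 (hecke p f).
Proof.
move=> p7 [c ->]; rewrite hecke_sum; apply: W5b_sum => m _; rewrite heckeZ; apply/W5bZ/W5b_Dspan.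
have S : Dspan (fun e => (e < 6 * m + 5)%N && (e %% 6 == (6 * m + 5) %% 6)%N) (hecke p (W5_pow m)).
  by case/orP: p7 => /eqP ->; [exact: hecke7_Dspan | exact: hecke13_Dspan].
apply: Dspan_sub S => e /=; move: (ltn_ord m); move: (nat_of_ord m) => j; lia.
Qed.

Lemma W5b_iter p n B f : (p == 7%N) || (p == 13%N) -> W5b B f -> W5b (B - n) (iter n (hecke p) f).
Proof.
move=> p7 fB; elim: n => [|n IH]; first by rewrite subn0.
by rewrite subnS; apply: W5b_hecke.
Qed.

Lemma W5b_0 f : W5b 0 f -> f = 0.
Proof. by case=> c ->; rewrite big_ord0. Qed.

(* On combinations of the W5_pow (interleave i j) with i > 0, hecke 7 is injective:
   the term of largest weight has a leading term that nothing else can cancel. *)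
Lemma hecke7_injective B (c : nat -> 'F_2) :
  (forall m, even_bits m = 0%N -> c m = 0) ->
  hecke 7 (\sum_(m < B) c m *: W5_pow m) = 0 -> forall m, (m < B)%N -> c m = 0.
Proof.
move=> c0 X0 m1 m1B; apply/eqP/negPn/negP => cm1.
have [m cm max_m] : exists2 m : 'I_B, c m != 0 & forall n : 'I_B, c n != 0 -> (weight n <= weight m)%N.
  by case: (@arg_maxnP _ (Ordinal m1B) (fun n : 'I_B => c n != 0) (fun n => weight n) cm1) => m; exists m.
have ipos (n : 'I_B) : c n != 0 -> (0 < even_bits n)%N.
  by move=> cn; rewrite lt0n; apply: contra cn => /eqP /c0 ->.
pose pr n := interleave (even_bits n).-1 (even_bits n./2).
have leadE (n : 'I_B) : c n != 0 -> lead7 (even_bits n) (even_bits n./2) = W5_pow (pr n).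
  by move/ipos; rewrite /lead7 /pr; case: (even_bits n).
have wpr (n : 'I_B) : c n != 0 -> (weight (pr n) + 2 = weight n)%N.
  by move/ipos; rewrite /pr weight_interleave /weight; lia.
have prI (n : 'I_B) : c n != 0 -> pr n = pr m -> n = m.
  move=> cn e; apply: val_inj; rewrite /= -[LHS]interleave_bits -[RHS]interleave_bits.
  have e1 := congr1 even_bits e; have e2 := congr1 (fun x => even_bits x./2) e.
  rewrite /pr !even_bits_interleave !odd_bits_interleave in e1 e2.
  by have h1 := ipos n cn; have h2 := ipos m cm; rewrite e2; congr interleave; lia.
apply: (@Dspan_indep (6 * pr m + 5)).
pose Q e := (e != 6 * pr m + 5)%N.
have T (n : 'I_B) : c n != 0 -> Dspan Q (hecke 7 (W5_pow n) + W5_pow (pr n)).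
  move=> cn; have := trace7_leading (even_bits n) (even_bits n./2).
  rewrite /trace7_bound interleave_bits leadE // -/(weight n).
  apply: Dspan_sub => e /andP [e5 we]; rewrite /Q; apply/eqP => ee.
  have := max_m n cn; have := wpr m cm; move: we; rewrite ee.
  by rewrite (_ : ((6 * pr m + 5) %/ 6 = pr m)%N); lia.
have S : Dspan Q (\sum_(n < B) c n *: (hecke 7 (W5_pow n) + W5_pow (pr n))).
  apply: Dspan_sum => n _; rewrite scaleF2; case: eqP => [_|/eqP cn]; [exact: Dspan0 | exact: T].
have R : Dspan Q (\sum_(n < B | n != m) c n *: W5_pow (pr n)).
  apply: Dspan_sum => n nm; rewrite scaleF2; case: eqP => [_|/eqP cn]; first exact: Dspan0.
  apply: Dspan_pow; rewrite /Q; apply: contra nm => /eqP e; apply/eqP/prI => //; lia.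
have := DspanD S R; rewrite (eq_bigr (fun n : 'I_B => c n *: hecke 7 (W5_pow n) + c n *: W5_pow (pr n))); last first.
  by move=> n _; rewrite scalerDr.
rewrite big_split /= [X in X + _ + _](_ : _ = 0); last first.
  transitivity (hecke 7 (\sum_(m < B) c m *: W5_pow m)); last exact: X0.
  by rewrite hecke_sum; apply: eq_bigr => n _; rewrite heckeZ.
by rewrite add0r (bigD1 m) //= -addrA addff addr0 scaleF2 (negbTE cm).
Qed.

(** Coordinates obtained by choice. [row_sum_inj] only combines the chosen coordinates of given
    elements, so linearity in f is never invoked. *)
Definition W5_coord B (f : fps 'F_2) : nat -> 'F_2 :=
  if pselect (W5b B f) is left H then projT1 (cid H) else fun=> 0.

Lemma W5_coordP B f : W5b B f -> f = \sum_(m < B) W5_coord B f m *: W5_pow m.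
Proof. by rewrite /W5_coord; case: pselect => // H _; exact: projT2 (cid H). Qed.

Section Socle.
Variable r : nat.
Let B := (4 ^ r)%N.
Let Y := hecke 13.
Let th := D ^+ (1 + 4 ^ r.+1).
Let K f := W5b B f /\ hecke 7 f = 0.

Let K0 : K 0. Proof. by split; [exact: W5b0 | rewrite hecke0]. Qed.
Let KD f g : K f -> K g -> K (f + g).
Proof. by move=> [fB f0] [gB g0]; split; [exact: W5bD | rewrite heckeD f0 g0 addr0]. Qed.
Let KZ c f : K f -> K (c *: f).
Proof. by move=> [fB f0]; split; [exact: W5bZ | rewrite heckeZ f0 scaler0]. Qed.
Let K_sum (I : finType) (g : I -> fps 'F_2) : (forall i, K (g i)) -> K (\sum_i g i).
Proof. by move=> H; elim/big_ind: _ => //. Qed.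

Let K_Y f : K f -> K (Y f).
Proof.
move=> [fB f0]; split; first by apply: W5b_le (W5b_hecke _ fB) => //; exact: leq_pred.
by rewrite /Y heckeC // f0 hecke0.
Qed.

Let K_iter n f : K f -> K (iter n Y f).
Proof. by move=> Kf; elim: n => //= n; exact: K_Y. Qed.

Let iterY0 n : iter n Y 0 = 0.
Proof. by elim: n => //= n ->; rewrite /Y hecke0. Qed.
Let iterYD n f g : iter n Y (f + g) = iter n Y f + iter n Y g.
Proof. by elim: n => //= n ->; rewrite /Y heckeD. Qed.
Let iterYZ n c f : iter n Y (c *: f) = c *: iter n Y f.
Proof. by elim: n => //= n ->; rewrite /Y heckeZ. Qed.
Let iterY_sum n (I : finType) (g : I -> fps 'F_2) : iter n Y (\sum_i g i) = \sum_i iter n Y (g i).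
Proof. exact: (big_morph _ (iterYD n) (iterY0 n)). Qed.

Let K_th : K th.
Proof.
split; last by rewrite /th (_ : (4 ^ r.+1 = 2 ^ (2 * r.+1))%N) ?hecke7_theta // expnM.
apply/W5b_Dspan/Dspan_pow; rewrite /B expnS; have := expn_gt0 4 r.
have : (4 ^ r %% 3 = 1)%N by rewrite -modnXm exp1n.
lia.
Qed.

Let nilp f : K f -> iter B Y f = 0.
Proof. by move=> [fB _]; apply: W5b_0; have := W5b_iter B (isT : (13 == 7) || (13 == 13))%N fB; rewrite subnn. Qed.

(* An element of K is determined by its coordinates on the W5_pow (interleave 0 j). *)
Let row f : 'rV['F_2]_(2 ^ r) := \row_j W5_coord B f (interleave 0 j).

Let row_sum_inj (I : finType) (u : I -> 'F_2) (g : I -> fps 'F_2) :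
  (forall i, K (g i)) -> \sum_i u i *: row (g i) = 0 -> \sum_i u i *: g i = 0.
Proof.
move=> Kg R0; pose c m := \sum_i u i * W5_coord B (g i) m.
have E : \sum_i u i *: g i = \sum_(m < B) c m *: W5_pow m.
  under eq_bigr => i _ do rewrite (W5_coordP (Kg i).1) scaler_sumr.
  rewrite exchange_big; apply: eq_bigr => m _; rewrite scaler_suml.
  by apply: eq_bigr => i _; rewrite scalerA.
have X0 : hecke 7 (\sum_i u i *: g i) = 0.
  have : K (\sum_i u i *: g i) by apply: K_sum => i; apply: KZ.
  by case.
(* The hypothesis of [hecke7_injective] ranges over all m, while the rows control only m < B. *)
pose c' m := if (m < B)%N then c m else 0.
have E' : \sum_i u i *: g i = \sum_(m < B) c' m *: W5_pow m.
  by rewrite E; apply: eq_bigr => m _; rewrite /c' ltn_ord.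
rewrite E' big1 // => m _; rewrite (@hecke7_injective B c') ?scale0r // -?E' // => n n0.
rewrite /c'; case: ltnP => // nB; rewrite -(interleave_bits n) n0.
have jr := odd_bits_lt nB; set j := even_bits _ in jr *.
have := congr1 (fun w : 'rV_(2 ^ r) => w ord0 (Ordinal jr)) R0.
rewrite summxE mxE => R0j; rewrite -[RHS]R0j; apply: eq_bigr => i _.
by rewrite !mxE.
Qed.

(** Let Y^L th be the last nonzero element of the chain th, Y th, .... The chain has independent
    rows, so L + 1 <= 2^r, while L >= 2^r - 1; hence it spans K, and only multiples of Y^L th are
    annihilated by Y. *)
Lemma socle_level f : W5b B f -> hecke 7 f = 0 -> hecke 13 f = 0 -> f = 0 \/ f = D ^+ 5.
Proof.
move=> fB X0 Y0.
have th_neq0 : iter (2 ^ r).-1 Y th != 0.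
  apply/eqP => e; have := iter_hecke13_theta r; rewrite -/th -/Y e fcoef0 => /eqP.
  by rewrite eq_sym oner_eq0.
have th_lt n : iter n Y th != 0 -> (n <= B)%N.
  apply: contraR; rewrite -ltnNge => Bn; rewrite -(subnK (ltnW Bn)) iterD nilp //.
  by rewrite iterY0.
have exL : exists n, iter n Y th != 0 by exists (2 ^ r).-1.
case: (ex_maxnP exL th_lt) => L Lneq0 Lmax.
have rL : ((2 ^ r).-1 <= L)%N := Lmax _ th_neq0.
pose v (k : 'I_L.+1) := iter k Y th.
have Kv k : K (v k) := K_iter k K_th.
have zero n : (L < n)%N -> iter n Y th = 0.
  by move=> Ln; apply/eqP/negPn/negP => /Lmax; rewrite leqNgt Ln.
(* Y^(L - k) annihilates the members of the chain after the k-th, so the first coefficient that may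
   be nonzero is isolated. *)
have isolate (u : 'I_L.+1 -> 'F_2) (k : 'I_L.+1) : (forall j : 'I_L.+1, (j < k)%N -> u j = 0) ->
    iter (L - k) Y (\sum_j u j *: v j) = u k *: iter L Y th.
  move=> uk; rewrite iterY_sum (bigD1 k) //= big1 ?addr0.
    by rewrite iterYZ -iterD subnK // -ltnS.
  move=> j jk; rewrite iterYZ; have [lt|gt] := ltnP j k; first by rewrite uk ?scale0r.
  rewrite -iterD zero ?scaler0 //; have := ltn_ord k.
  have : nat_of_ord j != k by []. move: gt; lia.
have solve (u : 'I_L.+1 -> 'F_2) (P : pred 'I_L.+1) :
    (forall k, P k -> iter (L - k) Y (\sum_j u j *: v j) = 0) ->
    (forall j k : 'I_L.+1, (j < k)%N -> P k -> P j) -> forall k, P k -> u k = 0.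
  move=> H down k; have [n] := ubnP (nat_of_ord k); elim: n k => // n IH k kn Pk.
  have := isolate u k; rewrite H // => /(_ _)/esym.
  rewrite scaleF2 => e; apply/eqP/negPn/negP => uk0; move: e; rewrite (negbTE uk0).
  move=> e; move/eqP: Lneq0; apply; apply: e => j jk; apply: IH; last exact: down Pk.
  by rewrite (leq_trans jk).
pose M : 'M['F_2]_(L.+1, 2 ^ r) := \matrix_k row (v k).
have mulM (w : 'rV_L.+1) : w *m M = \sum_k w 0 k *: row (v k).
  by rewrite mulmx_sum_row; apply: eq_bigr => k _; rewrite rowK.
have freeM : row_free M.
  apply/inj_row_free => w wM; apply/rowP => k; rewrite mxE.
  apply: (solve (fun k => w 0 k) predT) => // j _.
  by rewrite row_sum_inj ?iterY0 // -mulM.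
have rankM : \rank M = L.+1 by apply/eqP.
have L2 : L.+1 = (2 ^ r)%N.
  apply/eqP; rewrite eqn_leq -{1}rankM rank_leq_col /=.
  by have := expn_gt0 2 r; move: rL; lia.
have fullM : row_full M by rewrite /row_full rankM L2.
have expand g : K g -> exists u : 'I_L.+1 -> 'F_2, g = \sum_k u k *: v k.
  move=> Kg; have /submxP [w ew] : (row g <= M)%MS by apply: submx_full.
  exists (fun k => w 0 k); apply: addff_eq0.
  (* To apply [row_sum_inj], g joins the chain as one more member, with coefficient 1. *)
  pose h (o : 'I_L.+2) := if unlift ord0 o is Some k then v k else g.
  pose uo (o : 'I_L.+2) := if unlift ord0 o is Some k then w 0 k else 1.
  have su (V : lmodType 'F_2) (H : 'I_L.+2 -> V) :
      \sum_o uo o *: H o = H ord0 + \sum_k w 0 k *: H (lift ord0 k).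
    rewrite big_ord_recl /uo unlift_none scale1r; congr (_ + _).
    by apply: eq_bigr => k _; rewrite liftK.
  have hl k : h (lift ord0 k) = v k by rewrite /h liftK.
  have h0 : h ord0 = g by rewrite /h unlift_none.
  have := @row_sum_inj _ uo h; rewrite !su h0.
  under [X in _ + X = 0 -> _]eq_bigr => k _ do rewrite hl.
  under [X in _ -> _ -> _ + X = 0]eq_bigr => k _ do rewrite hl.
  apply; first by move=> i; rewrite /h; case: (unlift _ i).
  rewrite -mulM -ew; apply/rowP => j; rewrite !mxE; exact: addff2.
have top g : K g -> Y g = 0 -> g = 0 \/ g = iter L Y th.
  move=> Kg Yg; have [u eg] := expand g Kg.
  have u0 : forall k : 'I_L.+1, (k < L)%N -> u k = 0.
    apply: (solve u (fun k : 'I_L.+1 => (k < L)%N)) => [k kL|j k jk kL]; last exact: ltn_trans kL.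
    by rewrite -eg -[(L - k)%N]prednK ?subn_gt0 // iterSr Yg iterY0.
  rewrite eg (bigD1 ord_max) //= big1 ?addr0 ?scaleF2; last first.
    move=> k kmax; rewrite u0 ?scale0r //; have := ltn_ord k; rewrite ltnS leq_eqVlt => /orP [/eqP e|//].
    by case/eqP: kmax; apply: val_inj.
  by case: ifP; [left | right].
(* D^5 is itself annihilated by T_7 and T_13, which identifies Y^L th. *)
have D5 : K (D ^+ 5) /\ Y (D ^+ 5) = 0.
  rewrite /Y hecke13_D_small //; split=> //; split; last by rewrite hecke7_D_small.
  by rewrite -[D ^+ 5]/(W5_pow 0); apply: W5b_pow; rewrite expn_gt0.
have := top _ D5.1 D5.2; have := top f (conj fB X0) Y0.
move=> [->|->]; [by left | move=> [D0|<-]; [|by right]].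
by move/eqP: (lead_neq0 (leadX 5 lead_D)).
Qed.
End Socle.

Lemma W5_socle f : W5 f -> hecke 7 f = 0 -> hecke 13 f = 0 -> f = 0 \/ f = D ^+ 5.
Proof.
move=> /W5P [B fB]; apply: (@socle_level B); apply: W5b_le fB.
by apply/ltnW/ltn_expl.
Qed.

(** * Module maps *)

Definition monom i j f := iter i (hecke 7) (iter j (hecke 13) f).

Lemma monomD i j : {morph monom i j : f g / f + g}.
Proof.
move=> f g; rewrite /monom; have -> : iter j (hecke 13) (f + g) = iter j (hecke 13) f + iter j (hecke 13) g.
  by elim: j => //= j ->; rewrite heckeD.
by elim: i => //= i ->; rewrite heckeD.
Qed.

Lemma monom0 i j : monom i j 0 = 0.
Proof.
rewrite /monom; have -> : iter j (hecke 13) 0 = 0 by elim: j => //= j ->; rewrite hecke0.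
by elim: i => //= i ->; rewrite hecke0.
Qed.

Lemma monomZ i j c f : monom i j (c *: f) = c *: monom i j f.
Proof. by rewrite !scaleF2; case: ifP => // _; rewrite monom0. Qed.

Lemma monom_sum i j (I : Type) (r : seq I) (P : pred I) (g : I -> fps 'F_2) :
  monom i j (\sum_(n <- r | P n) g n) = \sum_(n <- r | P n) monom i j (g n).
Proof. exact: (big_morph _ (monomD i j) (monom0 i j)). Qed.

Lemma monomM i j a b f : monom i j (monom a b f) = monom (i + a) (j + b) f.
Proof.
rewrite /monom !iterD; congr (iter i _ _).
have XY g : hecke 13 (iter a (hecke 7) g) = iter a (hecke 7) (hecke 13 g).
  by elim: a => //= a <-; rewrite [RHS]heckeC.
by elim: j => //= j ->; rewrite XY.
Qed.

Lemma monom_W5b i j B f : W5b B f -> W5b (B - j - i) (monom i j f).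
Proof. by move=> fB; apply: W5b_iter => //; apply: W5b_iter. Qed.

Lemma monom_W5b_le i j B f : W5b B f -> W5b B (monom i j f).
Proof. by move/(@monom_W5b i j); apply: W5b_le; lia. Qed.

Lemma monom_eq0 i j B f : W5b B f -> (B <= i)%N || (B <= j)%N -> monom i j f = 0.
Proof.
move=> fB h; apply: W5b_0; have := monom_W5b i j fB.
by rewrite (_ : (B - j - i = 0)%N) //; case/orP: h; lia.
Qed.

(** T_7 f and T_13 f satisfy the hypotheses one level lower in the filtration, so they vanish by
    induction and f lies in the socle; its coefficient at x^5 excludes D^5. *)
Lemma W5_nondegenerate f : W5 f -> (forall i j, fcoef (monom i j f) 5 = 0) -> f = 0.
Proof.
move=> /W5P [B]; elim: B f => [|B IH] f fB f0; first exact: W5b_0.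
have X0 : hecke 7 f = 0.
  apply: IH => [|i j]; first exact: (W5b_hecke _ fB).
  by rewrite -[hecke 7 f]/(monom 1 0 f) monomM f0.
have Y0 : hecke 13 f = 0.
  apply: IH => [|i j]; first exact: (W5b_hecke _ fB).
  by rewrite -[hecke 13 f]/(monom 0 1 f) monomM f0.
have fW : W5 f by apply/W5P; exists B.+1.
have [//|f5] := W5_socle fW X0 Y0.
have [_] := leadX 5 lead_D; rewrite -f5 => l5; have := f0 0%N 0%N.
by rewrite /= l5 => /eqP; rewrite oner_eq0.
Qed.

Local Notation odd_bits n := (even_bits n./2).

(** A monomial with i >= B or j >= B annihilates f, and every other pair (i, j) is coded by some k <
    4^B. *)
Lemma act_sum u B f : W5b B f -> act u f =
  \sum_(k < 4 ^ B) fcoef2 u (even_bits k) (odd_bits k) *: monom (even_bits k) (odd_bits k) f.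
Proof.
move=> fB; pose bits k := (even_bits k, odd_bits k).
have bitsI : injective bits by move=> k l [e o]; rewrite -(interleave_bits k) e o interleave_bits.
rewrite /act (@fsbigE _ _ _ _ _ [seq bits k | k <- iota 0 (4 ^ B)]) //.
- rewrite big_map (eq_bigl xpredT); last by move=> k; rewrite in_setT.
  by rewrite -{1}[(4 ^ B)%N]subn0 -/(index_iota 0 (4 ^ B)) big_mkord.
- by rewrite map_inj_uniq ?iota_uniq.
case=> i j _ /= ij; rewrite -/(monom i j f) (@monom_eq0 _ _ B) ?scaler0 //.
apply: contraR ij; rewrite negb_or -!ltnNge => /andP [iB jB].
apply/mapP; exists (interleave i j); last by rewrite /bits even_bits_interleave odd_bits_interleave.
rewrite mem_iota /= add0n interleave_lt //; exact: ltn_trans (ltn_expl _ _).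
Qed.

Lemma act_W5b u B f : W5b B f -> W5b B (act u f).
Proof.
by move=> fB; rewrite (act_sum u fB); apply: W5b_sum => k _; apply/W5bZ/monom_W5b_le.
Qed.

Lemma monom_act i j u f : W5 f -> monom i j (act u f) = act u (monom i j f).
Proof.
move=> /W5P [B fB]; rewrite (act_sum u fB) (act_sum u (monom_W5b_le i j fB)) monom_sum.
by apply: eq_bigr => k _; rewrite monomZ !monomM addnC [(j + _)%N]addnC.
Qed.

Lemma act_monom i j : exists u, forall f, W5 f -> act u f = monom i j f.
Proof.
exists (FPS (fun b => FPS (fun a => ((a == i) && (b == j))%:R))) => f /W5P [B fB].
have {}fB := W5b_le (leq_addr (i + j) B) fB; rewrite (act_sum _ fB).
have lt : (interleave i j < 4 ^ (B + (i + j)))%N.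
  have le n : (n < 2 ^ n)%N := ltn_expl n (isT : 1 < 2)%N.
  apply: interleave_lt; [apply: leq_trans (le i) _ | apply: leq_trans (le j) _]; rewrite leq_exp2l //; lia.
rewrite (bigD1 (Ordinal lt)) //= even_bits_interleave odd_bits_interleave /fcoef2 /= !eqxx scale1r.
rewrite big1 ?addr0 // => k kij; case: eqP => [ek|_]; last by rewrite scale0r.
case: eqP => [ok|_]; last by rewrite scale0r.
by case/eqP: kij; apply: val_inj; rewrite /= -[LHS]interleave_bits ek ok.
Qed.

(** Dependent choice: later stages keep the earlier values, so the entry k is read off at stage k +
    1. *)
Lemma sequence_by_extension (A : Type) (a0 : A) (P : nat -> (nat -> A) -> Prop) :
  (forall n v w, (forall k, (k < n)%N -> v k = w k) -> P n v -> P n w) ->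
  (forall v, P 0%N v) ->
  (forall n v, P n v -> exists w, (forall k, (k < n)%N -> w k = v k) /\ P n.+1 w) ->
  exists u, forall n, P n u.
Proof.
move=> Pext P0 Pstep.
have step n v : exists w, P n v -> (forall k, (k < n)%N -> w k = v k) /\ P n.+1 w.
  by case: (pselect (P n v)) => [/Pstep [w]|nP]; [exists w | exists v].
pose us := fix us n := if n is m.+1 then projT1 (cid (step m (us m))) else fun=> a0.
have usP n : P n (us n).
  by elim: n => // n IH /=; case: cid => w /= /(_ IH) [].
have usE n k : (k < n)%N -> us n k = us k.+1 k.
  elim: n => // n IH; rewrite ltnS leq_eqVlt => /orP [/eqP -> //|kn].
  rewrite -IH //= ; case: cid => w /= /(_ (usP n)) [wE _]; exact: wE.
by exists (fun k => us k.+1 k) => n; apply: Pext (usP n) => k kn; exact: usE.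
Qed.

Definition coef_bits f k := fcoef (monom (even_bits k) (odd_bits k) f) 5.

Lemma coef_bitsD f g k : coef_bits (f + g) k = coef_bits f k + coef_bits g k.
Proof. by rewrite /coef_bits monomD. Qed.

Lemma W5D f g : W5 f -> W5 g -> W5 (f + g).
Proof.
move=> /W5P [B fB] /W5P [C gC]; apply/W5P; exists (B + C)%N.
by apply: W5bD; [apply: W5b_le fB | apply: W5b_le gC]; lia.
Qed.

(* A linear form on W5 is a combination of the coef_bits, the n-th coefficient being
   dictated by any f whose last nonzero value coef_bits f k is at k = n. *)
Lemma linear_form_coef_bits (phi : fps 'F_2 -> 'F_2) :
  (forall f g, W5 f -> W5 g -> phi (f + g) = phi f + phi g) ->
  exists u : nat -> 'F_2, forall n f, W5 f ->
    (forall k, (n <= k)%N -> coef_bits f k = 0) -> phi f = \sum_(k < n) u k * coef_bits f k.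
Proof.
move=> phiD.
apply: (@sequence_by_extension _ 0 (fun n u => forall f, W5 f ->
    (forall k, (n <= k)%N -> coef_bits f k = 0) -> phi f = \sum_(k < n) u k * coef_bits f k)).
- by move=> n v w vw vP f fW f0; rewrite vP //; apply: eq_bigr => k _; rewrite vw.
- move=> v f fW f0; rewrite big_ord0 (W5_nondegenerate fW) => [|i j].
    have W0 : W5 0 by apply/W5P; exists 0%N; exact: W5b0.
    by rewrite -[0 in LHS](addr0 0) phiD // addff2.
  by have := f0 (interleave i j); rewrite /coef_bits even_bits_interleave odd_bits_interleave; apply.
move=> n v vP; pose ext c k := if (k < n)%N then v k else c.
have extE c f : \sum_(k < n.+1) ext c k * coef_bits f k =
    \sum_(k < n) v k * coef_bits f k + c * coef_bits f n.
  rewrite big_ord_recr /= {2}/ext ltnn; congr (_ + _).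
  by apply: eq_bigr => k _; rewrite /ext ltn_ord.
have ext_v c k : (k < n)%N -> ext c k = v k by rewrite /ext => ->.
case: (pselect (exists f, [/\ W5 f, forall k, (n < k)%N -> coef_bits f k = 0 & coef_bits f n = 1])).
  (* The new coefficient is forced by g: modulo 2 it is the difference between [phi g] and the sum
     found so far. *)
  move=> [g [gW g0 gn]]; exists (ext (phi g + \sum_(k < n) v k * coef_bits g k)).
  split=> [|f fW f0]; first exact: ext_v.
  rewrite extE; have [fn|fn] := F2_cases (coef_bits f n).
    rewrite fn mulr0 addr0 vP // => k; rewrite leq_eqVlt => /orP [/eqP <- //|]; exact: f0.
  have : phi (f + g) = \sum_(k < n) v k * coef_bits (f + g) k.
    apply: vP => [|k]; first exact: W5D.
    rewrite coef_bitsD leq_eqVlt => /orP [/eqP <-|nk]; first by rewrite fn gn addff2.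
    by rewrite f0 // g0 // addr0.
  under eq_bigr => k _ do rewrite coef_bitsD mulrDr.
  rewrite phiD // big_split /= fn mulr1 => e; apply: (addIr (phi g)).
  by rewrite e -!addrA; congr (_ + _); rewrite addrCA addff2 addr0.
move=> H; exists (ext 0); split=> [|f fW f0]; first exact: ext_v.
rewrite extE mul0r addr0; apply: vP => // k; rewrite leq_eqVlt => /orP [/eqP <-|]; last exact: f0.
by have [//|fn] := F2_cases (coef_bits f n); case: H; exists f.
Qed.

Theorem theorem4p16 (T : fps 'F_2 -> fps 'F_2)
    (T_W5 : forall f, W5 f -> W5 (T f))
    (T_add : forall f g, W5 f -> W5 g -> T (f + g) = T f + T g)
    (T_act : forall u f, W5 f -> T (act u f) = act u (T f)) :
  exists u : fps2 'F_2, forall f, W5 f -> T f = act u f.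
Proof.
have [c cP] : exists c : nat -> 'F_2, forall n f, W5 f -> (forall k, (n <= k)%N -> coef_bits f k = 0) ->
    fcoef (T f) 5 = \sum_(k < n) c k * coef_bits f k.
  by apply: linear_form_coef_bits => f g fW gW; rewrite T_add.
(* In [fps2] the outer index is the exponent of Y, hence the order of j and i. *)
exists (FPS (fun j => FPS (fun i => c (interleave i j)))); set u := FPS _.
have T5 f : W5 f -> fcoef (T f) 5 = fcoef (act u f) 5.
  move=> fW; have /W5P [B fB] := fW; rewrite (act_sum u fB) fcoef_sum (cP (4 ^ B)%N) //.
    by apply: eq_bigr => k _; rewrite /fcoef2 /= interleave_bits.
  move=> k kB; rewrite /coef_bits (monom_eq0 fB) //; apply: contraTT kB.
  rewrite negb_or -!ltnNge => /andP [iB jB]; rewrite -(interleave_bits k).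
  by apply: interleave_lt; [exact: ltn_trans (ltn_expl _ _) | exact: ltn_trans (ltn_expl _ _)].
move=> f fW; apply: addff_eq0; apply: W5_nondegenerate => [|i j].
  apply: W5D; first exact: T_W5.
  by have /W5P [B fB] := fW; apply/W5P; exists B; apply: act_W5b.
rewrite monomD fcoefD monom_act //.
(* The hypothesis on T concerns [act] only, so the monomial is rewritten as the action of a power
   series. *)
have [m mP] := act_monom i j.
have mW : W5 (monom i j f) by have /W5P [B fB] := fW; apply/W5P; exists B; exact: monom_W5b_le.
rewrite -T5 // -(mP f fW) T_act // mP; last exact: T_W5.
exact: addff2.
Qed.
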